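(* Let $m \in \mathbb{Z}$. (i) Every Stein, normalized, $U$-equivariant disc bundle $\Omega_\rho \subset L^m$ over $Q^2$ is contained in $\Omega_{max} \subset L^m$. (ii) If such a Stein, normalized, $U$-equivariant disc bundle $\Omega_\rho\subset L^m$ does not coincide with $\Omega_{max}$, then the associated Stein, punctured disc bundle $\Omega_\rho^*$ is Kobayashi hyperbolic.
   Context: Let $U = SU(2)$, $K = \{\mathrm{diag}(e^{iy}, e^{-iy}) : y \in \mathbb{R}\} \subset U$, with universal complexifications $U^{\mathbb{C}} = SL(2,\mathbb{C})$ and $K^{\mathbb{C}} = \{\mathrm{diag}(\zeta,\zeta^{-1}) : \zeta \in \mathbb{C}^*\}$. Identify $K^{\mathbb{C}}$ with $\mathbb{C}^*$ via $\mathrm{diag}(\zeta,\zeta^{-1}) \mapsto \zeta$. The complex affine quadric $Q^2$ is identified with $U^{\mathbb{C}}/K^{\mathbb{C}}$. For $m \in \mathbb{Z}$ let $\chi^m : K^{\mathbb{C}} \to \mathbb{C}^*$, $\chi^m(\zeta) = \zeta^m$, and let $L^m = U^{\mathbb{C}} \times_{\chi^m} \mathbb{C}$ be the quotient of $U^{\mathbb{C}} \times \mathbb{C}$ by the $K^{\mathbb{C}}$-action $k \cdot (g,z) = (gk^{-1}, \chi^m(k) z)$, with classes $[g,z]$ and projection $L^m \to U^{\mathbb{C}}/K^{\mathbb{C}}$, $[g,z] \mapsto gK^{\mathbb{C}}$. The group $U$ acts on $L^m$ by $u\cdot[g,z]=[ug,z]$. Let $H = \begin{pmatrix} 0 & -1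 \\ 1 & 0 \end{pmatrix}$. Every $g \in U^{\mathbb{C}}$ has a Mostow decomposition $g = u \exp(ihH)\zeta^{-1}$ with $u \in U$, $h \in \mathbb{R}$, $\zeta \in K^{\mathbb{C}} \cong \mathbb{C}^*$; the numbers $|\zeta|$ and $|h|$ depend only on $g$. The $U$-equivariant disc bundles in $L^m$ (the $U$-invariant subdomains meeting every fiber of $L^m$ in a disc, centered at zero, of finite radius) are exactly the sets $$\Omega_\rho := \{[g,z] \in L^m : |z|\,|\zeta|^m \rho(h) < 1\},$$ where $u\exp(ihH)\zeta^{-1}$ is a Mostow decomposition of $g$ and $\rho : \mathbb{R} \to \mathbb{R}^{>0}$ is an even, upper semicontinuous function. The bundle $\Omega_\rho$ is normalized if $\rho(0) = 1$. The associated punctured disc bundle is $\Omega_\rho^* := \{[g,z] \in \Omega_\rho : z \neq 0\}$, obtained by removing the zero section. Finally $\Omega_{max}\subset L^m$ denotes $\Omega_{\rho_{max}}$ with $\rho_{max}(h) := (\cosh 2h)^{|m|/2}$.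
   Formalization: The printed condition |z||ζ|^m ρ(h) < 1 depends on the representative of [g,z] when m ≠ 0 (it scales by |k|^{2m}); the formal Ω_ρ uses |z||ζ|^{-m} ρ(h) < 1, the well-defined U-invariant disc bundle {[u exp(ihH), z] : |z|ρ(h) < 1}. *)

(* Defs.v *)
From HB Require Import structures.
From mathcomp Require Import all_boot all_order all_algebra.
From mathcomp Require Import generic_quotient spectral.
From mathcomp Require Import complex.
From mathcomp Require Import all_classical all_reals all_analysis.

Set Implicit Arguments.
Unset Strict Implicit.
Unset Printing Implicit Defensive.

Import Order.TTheory GRing.Theory Num.Theory.
Import numFieldNormedType.Exports.

Local Open Scope classical_set_scope.
Local Open Scope complex_scope.
Local Open Scope ring_scope.
Local Open Scope quotient_scope.

(* R[i] seen only as a numClosedFieldType: its normed module structure is then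
   the complex one (over itself), so that [differentiable] and [derivable]
   below mean complex differentiability. *)
Definition Cplx (R : realType) : numClosedFieldType := R[i].

Definition realC (R : realType) (x : R) : Cplx R := x%:C.

Definition mx2 (R : realType) (a b c d : Cplx R) : 'M[Cplx R]_2 :=
  \matrix_(i, j) if i == 0 then (if j == 0 then a else b)
                 else (if j == 0 then c else d).

Definition SU2 (R : realType) : set 'M[Cplx R]_2 :=
  [set u | u \is unitarymx /\ \det u = 1].

(* [set_type] carries the subspace topology of the space of matrices *)
Definition SL2 (R : realType) : Type :=
  set_type [set g : 'M[Cplx R]_2 | \det g = 1].
HB.instance Definition _ (R : realType) := Topological.on (SL2 R).

Definition SL2mx (R : realType) (g : SL2 R) : 'M[Cplx R]_2 := set_val g.

(* the element of K^C = C^* with coordinate k, for k != 0 *)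
Definition torus (R : realType) (k : Cplx R) : 'M[Cplx R]_2 :=
  mx2 k 0 0 k^-1.

Section LineBundle.
Variables (R : realType) (m : int).
Local Notation C := (Cplx R).

Definition torus_orbit (p q : SL2 R * C) : Prop :=
  exists k : C, [/\ k != 0, SL2mx q.1 = SL2mx p.1 *m invmx (torus k)
                  & q.2 = k ^ m * p.2].

Definition torus_orbitb (p q : SL2 R * C) : bool := `[< torus_orbit p q >].

Lemma torus1 : torus (1 : C) = 1%:M.
Proof.
by apply/matrixP => i j; rewrite !mxE invr1; case: i j => [[|[|//]] ?] [[|[|//]] ?].
Qed.

Lemma torusM (k l : C) : torus k *m torus l = torus (k * l).
Proof.
apply/matrixP => i j; rewrite !mxE !big_ord_recl big_ord0 !mxE /= invfM.
by case: i j => [[|[|//]] ?] [[|[|//]] ?] /=; rewrite ?(mul0r, mulr0, addr0, add0r).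
Qed.

Lemma invmx_torus (k : C) : k != 0 -> invmx (torus k) = torus k^-1.
Proof.
move=> k0; have kV : torus k *m torus k^-1 = 1%:M by rewrite torusM divff// torus1.
have [ku _] := mulmx1_unit kV.
by apply: (can_inj (mulKmx ku)); rewrite mulmxV.
Qed.

Lemma torus_orbitb_equiv : equiv_class_of torus_orbitb.
Proof.
have reflO : reflexive torus_orbitb.
  move=> p; apply/asboolP; exists 1; split; first exact: oner_neq0.
  - by rewrite torus1 invmx1 mulmx1.
  - by rewrite exp1rz mul1r.
have symO p q : torus_orbit p q -> torus_orbit q p.
  move=> [k [k0 e1 e2]]; exists k^-1; split; first by rewrite invr_eq0.
  - by rewrite e1 !invmx_torus ?invr_eq0// -mulmxA torusM invrK mulVf// torus1 mulmx1.
  - by rewrite e2 mulrA -expfzMl mulVf// exp1rz mul1r.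
split => // [p q|q p r].
  by apply/idP/idP => /asboolP /symO ?; apply/asboolP.
move=> /asboolP [k [k0 e1 e2]] /asboolP [l [l0 e3 e4]]; apply/asboolP.
exists (l * k); split; first by rewrite mulf_neq0.
- by rewrite e3 e1 !invmx_torus ?mulf_neq0// -mulmxA torusM invfM mulrC.
- by rewrite e4 e2 mulrA expfzMl.
Qed.

Canonical torus_orbit_equiv := EquivRelPack torus_orbitb_equiv.

Definition L : Type := quotient_topology {eq_quot torus_orbit_equiv}.
HB.instance Definition _ := Topological.on L.

Definition Lclass (g : SL2 R) (z : C) : L :=
  \pi_({eq_quot torus_orbit_equiv})%qT (g, z).

(* SL(2,C) x C is a closed submanifold of the vector space of pairs (matrix,
   number): its holomorphic functions are locally the restrictions of
   holomorphic functions of the ambient space. *)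
Definition holomorphic_at (F : SL2 R * C -> C) (p : SL2 R * C) : Prop :=
  exists G : 'M[C]_2 * C -> C,
    (\forall y \near (SL2mx p.1, p.2), differentiable G y) /\
    (\forall q \near p, F q = G (SL2mx q.1, q.2)).

(* The complex structure of L is the quotient one: a function on an open set V
   is holomorphic if and only if its pull-back to SL(2,C) x C is. The values
   of f outside V are irrelevant. *)
Definition holomorphic_on (V : set L) (f : L -> C) : Prop :=
  forall g z, V (Lclass g z) ->
    holomorphic_at (fun p => f (Lclass p.1 p.2)) (g, z).

Definition holomorphic_hull (W A : set L) : set L :=
  [set x | W x /\ forall f : L -> C, holomorphic_on W f ->
     forall M : R, (forall y, A y -> `|f y| <= realC M) -> `|f x| <= realC M].

Definition stein (W : set L) : Prop :=
  [/\ open W,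
      forall x y, W x -> W y -> x <> y ->
        exists2 f : L -> C, holomorphic_on W f & f x <> f y
    & forall A, A `<=` W -> compact A -> compact (holomorphic_hull W A)].

Definition unit_disc : set C := [set t | `|t| < 1].

(* a holomorphic map from the unit disc to the open subset W of L: continuous,
   and pulling back holomorphic functions to holomorphic functions *)
Definition holomorphic_disc (W : set L) (phi : C -> L) : Prop :=
  [/\ forall t, unit_disc t -> W (phi t),
      forall t, unit_disc t -> {for t, continuous phi}
    & forall (V : set L) (f : L -> C), open V -> holomorphic_on V f ->
        forall t, unit_disc t -> V (phi t) -> derivable (f \o phi) t 1].

Definition poincare_dist (a b : C) : R :=
  let delta := complex.Re (`|a - b| / `|1 - Num.conj b * a| : R[i]) in
  ln ((1 + delta) / (1 - delta)).

(* s lists discs phi with points a, b: phi a is the end point of the previous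
   disc (x for the first one) and phi b the starting point of the next one
   (y for the last one) *)
Fixpoint disc_chain (W : set L) (x : L) (s : seq ((C -> L) * (C * C))) (y : L)
    : Prop :=
  match s with
  | [::] => x = y
  | (phi, (a, b)) :: s' =>
      [/\ holomorphic_disc W phi, unit_disc a, unit_disc b, phi a = x
        & disc_chain W (phi b) s' y]
  end.

Definition kobayashi_dist (W : set L) (x y : L) : \bar R :=
  ereal_inf [set (\sum_(d <- s) poincare_dist d.2.1 d.2.2)%:E
            | s in [set s | disc_chain W x s y]].

Definition kobayashi_hyperbolic (W : set L) : Prop :=
  forall x y, W x -> W y -> kobayashi_dist W x y = 0%E -> x = y.

End LineBundle.

Section DiscBundles.
Variable R : realType.
Local Notation C := (Cplx R).

Definition expmx (A : 'M[C]_2) : 'M[C]_2 :=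
  limn (series (fun n => (n`!%:R)^-1 *: A ^+ n)).

Definition Hmx : 'M[C]_2 := mx2 0 (-1) 1 0.

Definition mostow (g u : 'M[C]_2) (h : R) (k : C) : Prop :=
  [/\ SU2 u, k != 0
    & g = u *m expmx (('i * realC h) *: Hmx) *m invmx (torus k)].

Definition upper_semicontinuous (rho : R -> R) : Prop :=
  forall h a, rho h < a -> \forall y \near h, rho y < a.

(* the functions rho that define the U-equivariant disc bundles *)
Definition disc_bundle_profile (rho : R -> R) : Prop :=
  [/\ forall h, 0 < rho h, forall h, rho (- h) = rho h
    & upper_semicontinuous rho].

(* If g = u exp(ihH) k^-1 then [g, z] = [u exp(ihH), k^-m z], hence the exponent
   -m: with it the condition does not depend on the representative (g, z), nor
   on the Mostow decomposition of g since rho is even. *)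
Definition Omega (m : int) (rho : R -> R) : set (L R m) :=
  [set x | exists g z u h k, [/\ x = Lclass m g z, mostow (SL2mx g) u h k
                               & `|z| * `|k| ^ (- m) * realC (rho h) < 1]].

Definition Omega_punctured (m : int) (rho : R -> R) : set (L R m) :=
  [set x | Omega rho x /\ exists g z, x = Lclass m g z /\ z != 0].

Definition cosh (x : R) : R := (expR x + expR (- x)) / 2.

Definition rho_max (m : int) (h : R) : R := cosh (2 * h) `^ (`|m|%:~R / 2).

Definition Omega_max (m : int) : set (L R m) := Omega (rho_max m).

End DiscBundles.

Arguments Omega {R} m rho.
Arguments Omega_punctured {R} m rho.
Arguments Omega_max R m : clear implicits.

(* Main.v *)
(* Let c be the column of g on which the torus acts with the weight opposite to
   the one of the fibre coordinate (the first column for m >= 0, the second one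
   for m < 0), and let N0, N1 be the squared norms of the columns. The Mostow
   decomposition gives N0 N1 = cosh^2(2h), and Omega_rho becomes the set of the
   [g, z] with |z| |c|^|m| psi < 1, where psi = rho / rho_max is a function of
   N0 N1 and psi = 1 for Omega_max. On the complex line of unipotent matrices U(t)
   fixing c one has |c| = 1 and N0 N1 = 1 + |t|^2, so psi is there a radial
   function of t, equal to 1 at t = 0, and Steinness makes log psi subharmonic:
   the continuity principle for the discs t |-> [U(t), s] gives psi >= 1, which is
   (i); for the annuli tau |-> [U(t1 tau^n), s / tau] it gives that psi dominates a
   positive power of |t| as soon as psi is not constant. In the latter case, with
   u_i = z c_i^|m|, the holomorphic functions u_i and u_i^N g_a0 g_b1 are bounded
   on Omega_rho for N large and separate the points outside the zero section, so
   that the Schwarz lemma yields (ii). The continuity principle rests on the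
   maximum principle for functions that are only assumed complex differentiable,
   hence on Goursat's theorem. *)

Require Import Defs.
From mathcomp Require Import all_boot all_order all_algebra.
From mathcomp Require Import generic_quotient spectral.
From mathcomp Require Import complex ring lra.
From mathcomp Require Import all_classical all_reals all_analysis.

Set Implicit Arguments.
Unset Strict Implicit.
Unset Printing Implicit Defensive.

Import Order.TTheory GRing.Theory Num.Theory.
Import numFieldNormedType.Exports.

Local Open Scope classical_set_scope.
Local Open Scope ring_scope.

(** * Goursat's theorem on rectangles *)

(** The profile is only upper semicontinuous, so no differential criterion for subharmonicity
    applies. Each inequality on [psi] comes from a family of discs or annuli pushed out of the zero
    section by a real factor [s]: their boundaries stay in the bundle, while one interior point
    would have to lie on its edge. For the growth of [psi], upper semicontinuity at [h = 0] and
    [rho 0 = 1] provide a point close to [t = 0] where [psi] is smaller than at a given point with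
    [psi > 1]. The slope of [log psi] against [log |t|] between the two is positive but possibly
    small; the substitution [t = t1 tau ^ n] multiplies it by [n], until it beats the slope [1] of
    the factor [1 / tau]. This growth is what makes enough functions bounded: on the bundle
    [|u_i| < 1 / psi], while [|g_a0 g_b1|] is at most the square root of [N0 N1], so that a power of
    [u_i] compensates it. Steinness of the punctured bundle does not involve [psi]: removing the
    zero section from any Stein open subset of [L] leaves a Stein set. *)

Section Goursat.
Variable R : realType.
Implicit Types (f g : R -> R) (u v : R -> R -> R) (a b c d : R).

Definition itv_integral f a b : R := \int[lebesgue_measure]_(x in `[a, b]) f x.

Definition cont_on f a b := forall x, a <= x <= b -> {for x, continuous f}.

Lemma cont_on_integrable f a b : cont_on f a b ->
  lebesgue_measure.-integrable `[a, b] (EFin \o f).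
Proof.
move=> fc; apply: continuous_compact_integrable; first exact: segment_compact.
apply: continuous_in_subspaceT => x; rewrite inE/= in_itv/= => /fc; exact.
Qed.

Lemma cont_onB f g a b : cont_on f a b -> cont_on g a b ->
  cont_on (fun x => f x - g x) a b.
Proof. by move=> fc gc x xab; apply: cvgB; [exact: fc|exact: gc]. Qed.

Lemma cont_on_sub f a b a' b' : a <= a' -> b' <= b -> cont_on f a b ->
  cont_on f a' b'.
Proof.
move=> aa bb fc x /andP[ax xb]; apply: fc.
by rewrite (le_trans aa)// (le_trans xb).
Qed.

Lemma itv_integral_split f a b e : a <= e <= b -> cont_on f a b ->
  itv_integral f a b = itv_integral f a e + itv_integral f e b.
Proof.
move=> /andP[ae eb] fc; have fi := cont_on_integrable fc.
have := @Rintegral_itvB R f (BLeft a) (BRight b) e fi.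
rewrite !bnd_simp => /(_ ae eb) E.
rewrite /itv_integral -(Rintegral_itv_obnd_cbnd (b := BRight b) (r := e)) -?E.
  by rewrite addrC subrK.
by apply: integrableS fi => //; apply: subset_itvr; rewrite bnd_simp.
Qed.

Lemma itv_integralB f g a b : cont_on f a b -> cont_on g a b ->
  itv_integral (fun x => f x - g x) a b = itv_integral f a b - itv_integral g a b.
Proof. by move=> fc gc; apply: RintegralB => //; exact: cont_on_integrable. Qed.

Lemma itv_integralD f g a b : cont_on f a b -> cont_on g a b ->
  itv_integral (fun x => f x + g x) a b = itv_integral f a b + itv_integral g a b.
Proof. by move=> fc gc; apply: RintegralD => //; exact: cont_on_integrable. Qed.

Lemma itv_integral_cst k a b : a <= b -> itv_integral (fun=> k) a b = k * (b - a).
Proof.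
move=> ab; rewrite /itv_integral Rintegral_cst//= lebesgue_measure_itv/= lte_fin.
by move: ab; rewrite le_eqVlt => /predU1P[->|->//]; rewrite ltxx subrr !mulr0.
Qed.

Lemma le_itv_integral f g a b : cont_on f a b -> cont_on g a b ->
  (forall x, a <= x <= b -> f x <= g x) -> itv_integral f a b <= itv_integral g a b.
Proof.
move=> fc gc fg; apply: le_Rintegral => //; try exact: cont_on_integrable.
Qed.

Lemma cont_on_cst k a b : cont_on (fun=> k) a b.
Proof. by move=> x _; exact: cvg_cst. Qed.

Lemma norm_itv_integral f (k M : R) a b : a <= b -> cont_on f a b ->
  (forall x, a <= x <= b -> `|f x - k| <= M) ->
  `|itv_integral f a b - k * (b - a)| <= M * (b - a).
Proof.
move=> ab fc fM; rewrite -itv_integral_cst//.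
rewrite -itv_integralB//; last exact: cont_on_cst.
have gc := cont_onB fc (@cont_on_cst k a b).
rewrite ler_norml -mulNr -!itv_integral_cst//; apply/andP; split;
  apply: le_itv_integral => //; try exact: cont_on_cst;
  by move=> x /fM; rewrite ler_norml => /andP[].
Qed.

(** Differentiability at the single point [(s, t)], with partial derivatives [A] and [B]; nothing is
    asked of the derivatives at nearby points, which is the setting of Goursat's theorem. *)
Definition linear_at u (s t A B : R) := forall eps : R, 0 < eps ->
  exists2 del : R, 0 < del & forall s' t' : R, `|s' - s| < del -> `|t' - t| < del ->
   `|u s' t' - u s t - (A * (s' - s) + B * (t' - t))| <=
      eps * (`|s' - s| + `|t' - t|).

Lemma linear_at_contl u s t A B : linear_at u s t A B ->
  {for s, continuous (u ^~ t)}.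
Proof.
move=> /(_ 1 ltr01)[del del0 H]; apply/cvgrPdist_le => e e0.
near=> x.
have xs : `|x - s| < del.
  by rewrite distrC; near: x; apply: (@nbhsx_ballx _ R s del).
have xe : (`|A| + 1) * `|x - s| <= e.
  rewrite -ler_pdivlMl ?ltr_pwDr// distrC ltW//; near: x.
  apply: (@nbhsx_ballx _ R s _); rewrite mulr_gt0// invr_gt0 ltr_pwDr//.
have := H x t xs; rewrite !subrr normr0 => /(_ del0).
rewrite mulr0 !addr0 mul1r distrC => Hx.
rewrite (le_trans _ xe)// distrC mulrDl mul1r -normrM.
rewrite -[X in `|X|](subrK (A * (x - s))) (le_trans (ler_normD _ _))// addrC lerD2l.
by rewrite distrC.
Unshelve. all: by end_near. Qed.

Lemma linear_at_swap u s t A B : linear_at u s t A B ->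
  linear_at (fun t s => u s t) t s B A.
Proof.
move=> H e e0; have [del d0 {}H] := H e e0; exists del => // s' t' h1 h2.
by rewrite [_ * _ + _]addrC (addrC `|_|); exact: H.
Qed.

Lemma linear_at_contr u s t A B : linear_at u s t A B ->
  {for t, continuous (u s)}.
Proof. by move=> /linear_at_swap/linear_at_contl. Qed.

(** The complex derivative of [u + iv] is here [A + iB]. *)
Definition cauchy_riemann u v s t := exists A B,
  linear_at u s t A (- B) /\ linear_at v s t B A.

(* For [u + iv] holomorphic, the imaginary part of the integral of [(u + iv) dz]
   along the boundary of the rectangle [a, b] x [c, d]. *)
Definition flux u v a b c d :=
  itv_integral (fun t => u b t - u a t) c d -
  itv_integral (fun s => v s d - v s c) a b.

Lemma halfway a b : a <= b -> a <= (a + b) / 2 <= b.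
Proof. by move=> ab; apply/andP; split; lra. Qed.

Lemma half_interval (x x' l : R) : 0 < l -> x' = x \/ x' = (x + (x + l)) / 2 ->
  x <= x' /\ x' + l / 2 <= x + l.
Proof. by move=> l0 [->|->]; split; lra. Qed.

(** * Bisection of rectangles *)

Section rectangle.
Variables (u v : R -> R -> R) (a0 b0 c0 d0 : R).
Hypothesis CR : forall s t, a0 <= s <= b0 -> c0 <= t <= d0 ->
  cauchy_riemann u v s t.

Lemma CR_contu s : a0 <= s <= b0 -> cont_on (u s) c0 d0.
Proof. by move=> hs t ht; have [A [B [/linear_at_contr]]] := CR hs ht. Qed.

Lemma CR_contv t : c0 <= t <= d0 -> cont_on (v ^~ t) a0 b0.
Proof. by move=> ht s hs; have [A [B [_ /linear_at_contl]]] := CR hs ht. Qed.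

Lemma flux_splitl a b c d e : a0 <= a -> b <= b0 -> c0 <= c -> d <= d0 ->
  a <= e <= b -> c <= d ->
  flux u v a b c d = flux u v a e c d + flux u v e b c d.
Proof.
move=> aa bb cc dd aeb cd; have /andP[ae eb] := aeb.
have cu s : a0 <= s <= b0 -> cont_on (u s) c d.
  by move=> /CR_contu; exact: cont_on_sub.
have cv t : c0 <= t <= d0 -> cont_on (v ^~ t) a b.
  by move=> /CR_contv; exact: cont_on_sub.
rewrite /flux (@itv_integral_split _ a b e)//; last first.
  by apply: cont_onB; apply: cv; apply/andP; split; lra.
have -> : itv_integral (fun t => u b t - u a t) c d =
   itv_integral (fun t => u e t - u a t) c d +
   itv_integral (fun t => u b t - u e t) c d.
  rewrite -itv_integralD; first by congr itv_integral; apply/funext => t; ring.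
  1,2: by apply: cont_onB; apply: cu; apply/andP; split; lra.
ring.
Qed.

Lemma flux_splitr a b c d e : a0 <= a -> b <= b0 -> c0 <= c -> d <= d0 ->
  c <= e <= d -> a <= b ->
  flux u v a b c d = flux u v a b c e + flux u v a b e d.
Proof.
move=> aa bb cc dd aeb cd; have /andP[ae eb] := aeb.
have cu s : a0 <= s <= b0 -> cont_on (u s) c d.
  by move=> /CR_contu; exact: cont_on_sub.
have cv t : c0 <= t <= d0 -> cont_on (v ^~ t) a b.
  by move=> /CR_contv; exact: cont_on_sub.
rewrite /flux (@itv_integral_split _ c d e)//; last first.
  by apply: cont_onB; apply: cu; apply/andP; split; lra.
have -> : itv_integral (fun s => v s d - v s c) a b =
   itv_integral (fun s => v s e - v s c) a b +
   itv_integral (fun s => v s d - v s e) a b.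
  rewrite -itv_integralD; first by congr itv_integral; apply/funext => t; ring.
  1,2: by apply: cont_onB; apply: cv; apply/andP; split; lra.
ring.
Qed.

Let bad eta a b c d := eta * ((b - a) * (d - c)) < `|flux u v a b c d|.

(** Flux and area are both additive when a rectangle is cut into four equal ones, so an excess of
    the flux over [eta] times the area is inherited by a quarter, given here by its lower left
    corner. *)
Lemma bad_quarter (eta : R) a b c d : a0 <= a -> b <= b0 -> c0 <= c -> d <= d0 ->
  a <= b -> c <= d -> bad eta a b c d ->
  exists x y, [/\ x = a \/ x = (a + b) / 2, y = c \/ y = (c + d) / 2 &
    bad eta x (x + (b - a) / 2) y (y + (d - c) / 2)].
Proof.
move=> aa bb cc dd ab cd; apply: contraPP => H.
have Ha (x y : R) : x = a \/ x = (a + b) / 2 -> y = c \/ y = (c + d) / 2 ->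
    `|flux u v x (x + (b - a) / 2) y (y + (d - c) / 2)| <=
    eta * ((b - a) * (d - c)) / 4.
  move=> hx hy; rewrite leNgt; apply/negP => N; apply: H; exists x, y; split => //.
  by rewrite /bad; apply: le_lt_trans N; rewrite le_eqVlt; apply/orP; left;
     apply/eqP; field.
have ea : a + (b - a) / 2 = (a + b) / 2 by field.
have ea' : (a + b) / 2 + (b - a) / 2 = b by field.
have ec : c + (d - c) / 2 = (c + d) / 2 by field.
have ec' : (c + d) / 2 + (d - c) / 2 = d by field.
have H1 := Ha a c (or_introl erefl) (or_introl erefl).
have H2 := Ha a _ (or_introl erefl) (or_intror erefl).
have H3 := Ha _ c (or_intror erefl) (or_introl erefl).
have H4 := Ha _ _ (or_intror erefl) (or_intror erefl).
rewrite {Ha H}/bad ?ea ?ea' ?ec ?ec' in H1 H2 H3 H4 *.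
have /andP[h1 h2] := halfway ab; have /andP[h3 h4] := halfway cd.
apply/negP; rewrite -leNgt (@flux_splitl _ _ _ _ ((a + b) / 2)) ?h1//.
rewrite (@flux_splitr a _ _ _ ((c + d) / 2)) ?h3//; last lra.
rewrite (@flux_splitr ((a + b) / 2) _ _ _ ((c + d) / 2)) ?h3//; last lra.
rewrite (le_trans (ler_normD _ _))// (_ : eta * _ = eta * ((b - a) * (d - c)) / 4 +
  eta * ((b - a) * (d - c)) / 4 + (eta * ((b - a) * (d - c)) / 4 +
  eta * ((b - a) * (d - c)) / 4)); last by field.
by apply: lerD; apply: (le_trans (ler_normD _ _)); exact: lerD.
Qed.

Lemma slope_estimate (p q r x al s w e k A : R) :
  `|p - r - (A * (x + al - s) + w)| <= e / 2 * k ->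
  `|q - r - (A * (x - s) + w)| <= e / 2 * k -> `|p - q - A * al| <= e * k.
Proof.
by rewrite !ler_norml => /andP[? ?] /andP[? ?]; apply/andP; split; lra.
Qed.

(** By the Cauchy-Riemann equations the linear parts contribute [A * al * be] to each of the two
    integrals and cancel; only the errors of the linear approximations at [(s, t)] remain, which are
    quadratic in the sides. *)
Lemma flux_small (eta : R) s t : 0 < eta -> a0 <= s <= b0 -> c0 <= t <= d0 ->
  exists2 del, 0 < del & forall x y al be, 0 <= al -> 0 <= be ->
    al < del -> be < del -> a0 <= x -> x + al <= b0 -> c0 <= y -> y + be <= d0 ->
    x <= s <= x + al -> y <= t <= y + be ->
    `|flux u v x (x + al) y (y + be)| <= eta * (al + be) ^+ 2.
Proof.
move=> eta0 hs ht; have [A [B [Hu Hv]]] := CR hs ht.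
have eta2 : 0 < eta / 2 by lra.
have [du du0 {}Hu] := Hu _ eta2; have [dv dv0 {}Hv] := Hv _ eta2.
exists (Num.min du dv); first by rewrite lt_min du0.
move=> x y al be al0 be0; rewrite !lt_min => /andP[alu alv] /andP[beu bev].
move=> ax xb cy yd /andP[xs sx] /andP[yt ty].
have N2 (z z' w l : R) : w <= z <= w + l -> w <= z' <= w + l -> `|z' - z| <= l.
  by clear; move=> /andP[? ?] /andP[? ?]; rewrite !ler_norml; apply/andP; split; lra.
have hx : a0 <= x <= b0 by rewrite ax (le_trans _ xb)// lerDl.
have hxa : a0 <= x + al <= b0 by rewrite xb (le_trans ax)// lerDl.
have hy : c0 <= y <= d0 by rewrite cy (le_trans _ yd)// lerDl.
have hyb : c0 <= y + be <= d0 by rewrite yd (le_trans cy)// lerDl.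
have xal : x <= x + al by rewrite lerDl.
have ybe : y <= y + be by rewrite lerDl.
have Eu : `|itv_integral (fun t => u (x + al) t - u x t) y (y + be) - A * al * be|
    <= eta * (al + be) * be.
  have -> : A * al * be = A * al * (y + be - y) by ring.
  have -> : eta * (al + be) * be = eta * (al + be) * (y + be - y) by ring.
  apply: norm_itv_integral => //.
    by apply: (@cont_on_sub _ c0 d0) => //; apply: cont_onB; exact: CR_contu.
  move=> th hth.
  have t1 : `|th - t| <= be by apply: (N2 _ _ y) => //; rewrite yt.
  have s1 : `|x + al - s| <= al by apply: (N2 _ _ x); rewrite ?xs ?lexx ?lerDl ?al0.
  have s2 : `|x - s| <= al by apply: (N2 _ _ x); rewrite ?xs ?lexx ?lerDl ?al0.
  have h1 := Hu _ _ (le_lt_trans s1 alu) (le_lt_trans t1 beu).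
  have h2 := Hu _ _ (le_lt_trans s2 alu) (le_lt_trans t1 beu).
  have h3 : eta / 2 * (`|x + al - s| + `|th - t|) <= eta / 2 * (al + be).
    by rewrite ler_pM2l// lerD.
  have h4 : eta / 2 * (`|x - s| + `|th - t|) <= eta / 2 * (al + be).
    by rewrite ler_pM2l// lerD.
  exact: slope_estimate (le_trans h1 h3) (le_trans h2 h4).
have Ev : `|itv_integral (fun s => v s (y + be) - v s y) x (x + al) - A * be * al|
    <= eta * (al + be) * al.
  have -> : A * be * al = A * be * (x + al - x) by ring.
  have -> : eta * (al + be) * al = eta * (al + be) * (x + al - x) by ring.
  apply: norm_itv_integral => //.
    by apply: (@cont_on_sub _ a0 b0) => //; apply: cont_onB; exact: CR_contv.
  move=> th hth.
  have t1 : `|th - s| <= al by apply: (N2 _ _ x) => //; rewrite xs.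
  have s1 : `|y + be - t| <= be by apply: (N2 _ _ y); rewrite ?yt ?lexx ?lerDl ?be0.
  have s2 : `|y - t| <= be by apply: (N2 _ _ y); rewrite ?yt ?lexx ?lerDl ?be0.
  have h1 := Hv _ _ (le_lt_trans t1 alv) (le_lt_trans s1 bev).
  have h2 := Hv _ _ (le_lt_trans t1 alv) (le_lt_trans s2 bev).
  have h3 : eta / 2 * (`|th - s| + `|y + be - t|) <= eta / 2 * (al + be).
    by rewrite ler_pM2l// lerD.
  have h4 : eta / 2 * (`|th - s| + `|y - t|) <= eta / 2 * (al + be).
    by rewrite ler_pM2l// lerD.
  move: (le_trans h1 h3) (le_trans h2 h4); rewrite ![B * _ + _]addrC.
  exact: slope_estimate.
rewrite /flux (_ : eta * _ = eta * (al + be) * be + eta * (al + be) * al); last by ring.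
set p := itv_integral _ y _ in Eu *; set q := itv_integral _ x _ in Ev *.
rewrite (_ : p - q = (p - A * al * be) - (q - A * be * al)); last by ring.
by rewrite (le_trans (ler_normB _ _))// lerD.
Qed.

Lemma flux_bound (eta : R) : a0 <= b0 -> c0 <= d0 -> 0 < eta -> a0 < b0 -> c0 < d0 ->
  `|flux u v a0 b0 c0 d0| <= eta * ((b0 - a0) * (d0 - c0)).
Proof.
move=> ab cd eta0 ab' cd'; rewrite leNgt; apply/negP => Hbad.
pose al n := (b0 - a0) / 2 ^+ n; pose be n := (d0 - c0) / 2 ^+ n.
have al0 n : 0 < al n by rewrite /al divr_gt0 ?exprn_gt0// subr_gt0.
have be0 n : 0 < be n by rewrite /be divr_gt0 ?exprn_gt0// subr_gt0.
have alS n : al n.+1 = al n / 2 by rewrite /al exprS; field; rewrite expf_eq0 pnatr_eq0 andbF.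
have beS n : be n.+1 = be n / 2 by rewrite /be exprS; field; rewrite expf_eq0 pnatr_eq0 andbF.
(* A bad rectangle of generation [n] is encoded by its lower left corner together with [n], which
   determines its sides [al n] and [be n]. *)
pose P (z : R * R * nat) := let: (x, y, n) := z in
  [/\ a0 <= x, x + al n <= b0, c0 <= y, y + be n <= d0 &
    bad eta x (x + al n) y (y + be n)].
pose Rel (p q : {z | P z}) := let: (x, y, n) := sval p in let: (x', y', n') := sval q in
  [/\ n' = n.+1, x <= x' , x' + al n' <= x + al n, y <= y' & y' + be n' <= y + be n].
have ex p : {q | Rel p q}.
  apply: cid; case: p => -[[x y] n] [/= h1 h2 h3 h4 hb].
  have h5 : x <= x + al n by rewrite lerDl ltW.
  have h6 : y <= y + be n by rewrite lerDl ltW.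
  have [x' [y' [hx hy]]] := bad_quarter h1 h2 h3 h4 h5 h6 hb.
  have -> : (x + al n - x) / 2 = al n.+1 by rewrite alS; ring.
  have -> : (y + be n - y) / 2 = be n.+1 by rewrite beS; ring.
  move=> hb'.
  have hx' : x <= x' /\ x' + al n.+1 <= x + al n.
    by rewrite alS; exact: half_interval hx.
  have hy' : y <= y' /\ y' + be n.+1 <= y + be n.
    by rewrite beS; exact: half_interval hy.
  have [x1 x2] := hx'; have [y1 y2] := hy'.
  have hP : P (x', y', n.+1).
    by split => //; [exact: le_trans h1 x1|exact: le_trans x2 h2|
      exact: le_trans h3 y1|exact: le_trans y2 h4].
  by exists (exist _ (x', y', n.+1) hP); split.
have al00 : al 0 = b0 - a0 by rewrite /al expr0 divr1.
have be00 : be 0 = d0 - c0 by rewrite /be expr0 divr1.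
have P0 : P (a0, c0, 0).
  by split; rewrite ?al00 ?be00 ?(addrC a0) ?(addrC c0) ?subrK.
have [f [f0 fR]] := dependent_choice ex (exist _ _ P0).
pose x n := (sval (f n)).1.1; pose y n := (sval (f n)).1.2.
have fE n : sval (f n) = (x n, y n, n).
  rewrite /x /y; have : (sval (f n)).2 = n.
    elim: n => [|n IH]; first by rewrite f0.
    by have := fR n; rewrite /Rel; move: IH; case: (sval (f n)) => -[? ?] ? /= ->;
      case: (sval (f n.+1)) => -[? ?] ? [].
  by case: (sval (f n)) => -[? ?] ? /= ->.
have fP n : P (x n, y n, n) by rewrite -fE; exact: (svalP (f n)).
have fS n : [/\ x n <= x n.+1, x n.+1 + al n.+1 <= x n + al n,
    y n <= y n.+1 & y n.+1 + be n.+1 <= y n + be n].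
  by have := fR n; rewrite /Rel !fE => -[].
(* Nested closed intervals share a point: the supremum of their left ends. *)
have sup_in (z l : nat -> R) : (forall n, 0 < l n) ->
    (forall n, z n <= z n.+1 /\ z n.+1 + l n.+1 <= z n + l n) ->
    exists s, forall n, z n <= s <= z n + l n.
  move=> l0 zS.
  have zm m n : (m <= n)%N -> z m <= z n.
    by apply: (@homo_leq _ _ (<=%R)) => // [? ? ?|k]; [exact: le_trans|case: (zS k)].
  have zd m n : (m <= n)%N -> z n + l n <= z m + l m.
    move=> /subnK <-; elim: (n - m)%N => // k IH; rewrite addSn.
    by apply: le_trans IH; case: (zS (k + m)%N).
  have zl m n : z m <= z n + l n.
    case: (leqP m n) => [/zm h|/ltnW/zd h].
      by apply: (le_trans h); rewrite lerDl ltW.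
    by apply: le_trans h; rewrite lerDl ltW.
  exists (sup (range z)) => n; apply/andP; split.
    apply: ub_le_sup; last by exists n.
    by exists (z 0 + l 0) => _ [m _ <-].
  by apply: ge_sup => [|_ [m _ <-]]; [exists (z 0); exists 0|].
have [s hs] := sup_in x al al0 (fun n => let: And4 p1 p2 _ _ := fS n in conj p1 p2).
have [t ht] := sup_in y be be0 (fun n => let: And4 _ _ p1 p2 := fS n in conj p1 p2).
have hs0 : a0 <= s <= b0.
  by case: (fP 0) => + + _ _ _; have /andP[] := hs 0 => *; apply/andP; split; lra.
have ht0 : c0 <= t <= d0.
  by case: (fP 0) => _ _ + + _; have /andP[] := ht 0 => *; apply/andP; split; lra.
(* All generations are similar rectangles, so with this [e] the bound [e * (al n + be n) ^+ 2]
   equals [eta * (al n * be n)] for every [n], against the badness of generation [n]. *)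
pose e := eta * ((b0 - a0) * (d0 - c0)) / ((b0 - a0) + (d0 - c0)) ^+ 2.
have ba0 : 0 < b0 - a0 by lra.
have dc0 : 0 < d0 - c0 by lra.
have e0 : 0 < e.
  apply: divr_gt0; last by apply: exprn_gt0; exact: addr_gt0.
  by apply: mulr_gt0 => //; exact: mulr_gt0.
have [del del0 Hd] := flux_small e0 hs0 ht0.
have [n [n1 n2]] : exists n, al n < del /\ be n < del.
  pose X := ((b0 - a0) + (d0 - c0)) / del; pose n := Num.bound X.
  have X0 : 0 <= X by rewrite divr_ge0 ?ltW// addr_gt0.
  have Xn : X < 2 ^+ n.
    by rewrite (lt_le_trans (archi_boundP X0))// -natrX ler_nat ltnW// ltn_expl.
  have n0 : (0 : R) < 2 ^+ n by rewrite exprn_gt0.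
  have : (b0 - a0) + (d0 - c0) < del * 2 ^+ n by rewrite mulrC -ltr_pdivrMr.
  by exists n; rewrite /al /be !ltr_pdivrMr//; split; lra.
have [h1 h2 h3 h4] := fP n; rewrite /bad => hb.
have := Hd (x n) (y n) (al n) (be n) (ltW (al0 n)) (ltW (be0 n)) n1 n2 h1 h2 h3 h4 (hs n) (ht n).
apply/negP; rewrite -ltNge; apply: le_lt_trans hb.
rewrite le_eqVlt; apply/orP; left; apply/eqP.
rewrite /e /al /be; field.
by rewrite expf_eq0 pnatr_eq0 andbF gt_eqF//; lra.
Qed.

Lemma goursat : a0 < b0 -> c0 < d0 -> flux u v a0 b0 c0 d0 = 0.
Proof.
move=> ab cd; apply/eqP; rewrite -normr_le0; apply/ler_addgt0Pl => e e0.
have p0 : 0 < (b0 - a0) * (d0 - c0) by rewrite mulr_gt0 ?subr_gt0.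
have := flux_bound (ltW ab) (ltW cd) (divr_gt0 e0 p0) ab cd.
by rewrite divfK ?gt_eqF// addr0.
Qed.

End rectangle.
End Goursat.

(** * Complex differentiability and the mean value property *)

Section ComplexPlane.
Variable R : realType.
Local Notation C := (Cplx R).
Implicit Types (z w : C) (x y : R).

(** The norm of [C] is itself an element of [C]; this is the same modulus in [R], where the order is
    total. *)
Definition cmod z : R := complex.Re (`|z| : R[i]).

Lemma normcE z : `|z| = realC (cmod z).
Proof. rewrite /realC /cmod RRe_real//; exact: normr_real. Qed.

Lemma realCD x y : realC (x + y) = realC x + realC y. Proof. exact: rmorphD. Qed.
Lemma realCB x y : realC (x - y) = realC x - realC y. Proof. exact: rmorphB. Qed.
Lemma realCN x : realC (- x) = - realC x. Proof. exact: rmorphN. Qed.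
Lemma realCM x y : realC (x * y) = realC x * realC y. Proof. exact: rmorphM. Qed.
Lemma realCX x n : realC (x ^+ n) = realC x ^+ n. Proof. exact: rmorphXn. Qed.
Lemma realCV x : realC x^-1 = (realC x)^-1. Proof. exact: fmorphV. Qed.
Lemma realC0 : realC 0 = 0 :> C. Proof. by []. Qed.
Lemma realC1 : realC 1 = 1 :> C. Proof. by []. Qed.
Lemma ler_realC x y : (realC x <= realC y) = (x <= y). Proof. exact: lecR. Qed.
Lemma ltr_realC x y : (realC x < realC y) = (x < y). Proof. exact: ltcR. Qed.
Lemma realC_inj : injective (@realC R). Proof. exact: complexI. Qed.
Lemma conj_realC x : (realC x)^* = realC x.
Proof. by apply: CrealP; apply/complex_realP; exists x. Qed.
Lemma cmod_realC x : cmod (realC x) = `|x|.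
Proof. rewrite /cmod normc_def/= expr0n addr0 sqrtr_sqr//. Qed.

Lemma cmod_ge0 z : 0 <= cmod z.
Proof. by rewrite -ler_realC -normcE; exact: normr_ge0. Qed.
Lemma cmod0 : cmod 0 = 0. Proof. by rewrite /cmod normr0. Qed.
Lemma cmod1 : cmod 1 = 1. Proof. by rewrite /cmod normr1. Qed.
Lemma cmodM z w : cmod (z * w) = cmod z * cmod w.
Proof. by apply: realC_inj; rewrite realCM -!normcE normrM. Qed.
Lemma cmodX z n : cmod (z ^+ n) = cmod z ^+ n.
Proof. by apply: realC_inj; rewrite realCX -!normcE normrX. Qed.
Lemma cmodV z : cmod z^-1 = (cmod z)^-1.
Proof. by apply: realC_inj; rewrite realCV -!normcE normfV. Qed.
Lemma cmodN z : cmod (- z) = cmod z. Proof. by rewrite /cmod normrN. Qed.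
Lemma cmodD z w : cmod (z + w) <= cmod z + cmod w.
Proof. by rewrite -ler_realC realCD -!normcE ler_normD. Qed.
Lemma cmodB z w : cmod (z - w) = cmod (w - z). Proof. by rewrite /cmod distrC. Qed.
Lemma cmod_eq0 z : (cmod z == 0) = (z == 0).
Proof. by rewrite -(inj_eq realC_inj) -normcE realC0 normr_eq0. Qed.
Lemma cmod_gt0 z : (0 < cmod z) = (z != 0).
Proof. by rewrite lt_neqAle cmod_ge0 andbT eq_sym cmod_eq0. Qed.
Lemma cmod_conj z : cmod z^* = cmod z.
Proof. by rewrite /cmod norm_conjC. Qed.

Lemma sqr_cmod z : cmod z ^+ 2 = complex.Re z ^+ 2 + complex.Im z ^+ 2.
Proof. by rewrite /cmod normc_def/= sqr_sqrtr// addr_ge0// sqr_ge0. Qed.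

Lemma Re_le_cmod z : `|complex.Re z| <= cmod z.
Proof.
by rewrite -ler_sqr ?nnegrE ?cmod_ge0// sqr_cmod real_normK ?num_real// lerDl sqr_ge0.
Qed.
Lemma Im_le_cmod z : `|complex.Im z| <= cmod z.
Proof.
by rewrite -ler_sqr ?nnegrE ?cmod_ge0// sqr_cmod real_normK ?num_real// lerDr sqr_ge0.
Qed.

Definition cplx x y : C := Complex x y.

Lemma cplx_ReIm z : cplx (complex.Re z) (complex.Im z) = z. Proof. by case: z. Qed.

Lemma cmod_cplx_le x y : cmod (cplx x y) <= `|x| + `|y|.
Proof.
rewrite -ler_sqr ?nnegrE ?cmod_ge0 ?addr_ge0// sqr_cmod/= sqrrD !real_normK ?num_real//.
by rewrite addrAC lerDl mulrn_wge0// mulr_ge0.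
Qed.

Lemma gt0_realC (e : C) : 0 < e -> exists2 x : R, 0 < x & e = realC x.
Proof.
move=> e0; exists (complex.Re e); last by rewrite /realC RRe_real ?gtr0_real.
by move: e0; rewrite ltcE => /andP[].
Qed.

Lemma nbhsCP (z : C) (P : set C) :
  nbhs z P <-> exists2 d : R, 0 < d & forall w, cmod (w - z) < d -> P w.
Proof.
split.
  move=> /nbhs_ballP[e /gt0_realC[d d0 ->] H]; exists d => // w hw.
  by apply: H; rewrite -ball_normE /= normcE ltr_realC cmodB.
move=> [d d0 H]; apply/nbhs_ballP; exists (realC d); first by rewrite /= -realC0 ltr_realC.
by move=> w; rewrite -ball_normE /= normcE ltr_realC cmodB; exact: H.
Qed.

Lemma continuousCP (f : C -> C) z : {for z, continuous f} <->
  forall e : R, 0 < e -> exists2 d : R, 0 < d &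
    forall w, cmod (w - z) < d -> cmod (f w - f z) < e.
Proof.
split.
  move=> fc e e0.
  have /fc : nbhs (f z) [set w | cmod (w - f z) < e] by apply/nbhsCP; exists e.
  by move=> /nbhsCP.
move=> H P /nbhsCP[e /H[d d0 Hd] HP]; apply/nbhsCP; exists d => // w /Hd.
exact: HP.
Qed.

(** Division-free form of [f] having derivative [c] at [z]. It makes sense at [w = z] too, which
    suits compositions. *)
Definition cdiff (f : C -> C) z c := forall e : R, 0 < e -> exists2 d : R, 0 < d &
  forall w, cmod (w - z) < d -> cmod (f w - f z - c * (w - z)) <= e * cmod (w - z).

Lemma derivable_cdiff (f : C -> C) z : derivable f z 1 -> exists c, cdiff f z c.
Proof.
move=> /cvg_ex[c /= Hc]; exists c => e e0.
have : nbhs c [set w | cmod (w - c) < e] by apply/nbhsCP; exists e.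
move=> /Hc; rewrite /= => /nbhsCP[d d0 H]; exists d => // w wd.
have [->|wz] := eqVneq w z; first by rewrite !subrr mulr0 subr0 cmod0 mulr0.
have := H (w - z); rewrite subr0 => /(_ wd); rewrite subr_eq0 => /(_ wz) /=.
rewrite [_ *: 1]mulr1 subrK => h.
have -> : f w - f z - c * (w - z) = ((w - z)^-1 * (f w - f z) - c) * (w - z).
  by field; rewrite subr_eq0.
by rewrite cmodM ler_wpM2r ?cmod_ge0// ltW.
Qed.

Lemma cdiff_derivable (f : C -> C) z c : cdiff f z c -> derivable f z 1.
Proof.
move=> H; apply/cvg_ex; exists c => /= P /nbhsCP[e e0 HP].
have [d d0 Hd] := H (e / 2) (divr_gt0 e0 (ltr0n _ 2)).
apply/nbhsCP; exists d => // w; rewrite subr0 => wd w0; apply: HP.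
have := Hd (w + z); rewrite addrK => /(_ wd); rewrite [_ *: 1]mulr1.
have -> : f (w + z) - f z - c * w = (w^-1 * (f (w + z) - f z) - c) * w.
  by field.
rewrite cmodM ler_pM2r ?cmod_gt0// => /le_lt_trans; apply.
by rewrite ltr_pdivrMr// ltr_pMr// ltr1n.
Qed.

Lemma cdiff_comp (f g : C -> C) z c d :
  cdiff f z c -> cdiff g (f z) d -> cdiff (g \o f) z (d * c).
Proof.
move=> Hf Hg e e0.
pose e1 := Num.min 1 (e / (2 * (cmod d + 1))).
have d1 : 0 < cmod d + 1 by rewrite ltr_wpDl ?cmod_ge0.
have e10 : 0 < e1 by rewrite lt_min ltr01 divr_gt0// mulr_gt0.
have [df df0 {}Hf] := Hf _ e10.
pose e2 := e / (2 * (cmod c + 1)).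
have c1 : 0 < cmod c + 1 by rewrite ltr_wpDl ?cmod_ge0.
have e20 : 0 < e2 by rewrite divr_gt0// mulr_gt0.
have [dg dg0 {}Hg] := Hg _ e20.
exists (Num.min df (dg / (cmod c + 1))); first by rewrite lt_min df0 divr_gt0.
move=> w; rewrite lt_min => /andP[wf wg].
have h1 := Hf w wf.
have hfw : cmod (f w - f z) <= (cmod c + 1) * cmod (w - z).
  rewrite -[f w - f z](subrK (c * (w - z))) (le_trans (cmodD _ _))// cmodM.
  rewrite mulrDl addrC lerD2l (le_trans h1)// ler_wpM2r ?cmod_ge0//.
  by rewrite /e1 ge_min lexx.
have hg1 : cmod (f w - f z) < dg.
  by rewrite (le_lt_trans hfw)// mulrC -ltr_pdivlMr.
have h2 := Hg _ hg1.
have -> : (g \o f) w - (g \o f) z - d * c * (w - z) =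
   (g (f w) - g (f z) - d * (f w - f z)) + d * (f w - f z - c * (w - z)).
  by rewrite /=; ring.
rewrite (le_trans (cmodD _ _))// cmodM [e]splitr mulrDl lerD//.
  rewrite (le_trans h2)// /e2 -(ler_pM2l (mulr_gt0 (ltr0n _ 2) c1)).
  have -> : 2 * (cmod c + 1) * (e / (2 * (cmod c + 1)) * cmod (f w - f z)) =
     e * cmod (f w - f z) by field; rewrite gt_eqF.
  rewrite (_ : 2 * _ * _ = e * ((cmod c + 1) * cmod (w - z))); last by field.
  by rewrite ler_pM2l.
rewrite (le_trans (ler_wpM2l (cmod_ge0 _) h1))// mulrA ler_wpM2r ?cmod_ge0//.
apply: (@le_trans _ _ ((cmod d + 1) * e1)).
  by rewrite ler_wpM2r ?(ltW e10)// lerDl.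
apply: (@le_trans _ _ ((cmod d + 1) * (e / (2 * (cmod d + 1))))).
  by rewrite ler_pM2l// /e1 ge_min lexx orbT.
by rewrite le_eqVlt; apply/orP; left; apply/eqP; field; rewrite gt_eqF.
Qed.

Lemma real_linear_approx (f : R -> R) (df : R) : is_derive (0 : R) 1 f df ->
  forall e : R, 0 < e -> exists2 d : R, 0 < d &
    forall x, `|x| < d -> `|f x - f 0 - df * x| <= e * `|x|.
Proof.
move=> [/cvg_ex[l /= Hl] dfE] e e0.
have {dfE} ld : l = df by rewrite -dfE; apply/esym/cvg_lim.
have /cvgrPdist_lt/(_ _ e0) := Hl => /nbhs_ballP[d /= d0 H]; exists d => // x xd.
have [->|x0] := eqVneq x 0; first by rewrite !subrr mulr0 subr0 normr0 mulr0.
have := H x; rewrite /ball/= sub0r normrN => /(_ xd x0).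
rewrite addr0 [_ *: 1]mulr1 ld distrC => h.
have -> : f x - f 0 - df * x = (x^-1 * (f x - f 0) - df) * x by field.
by rewrite normrM ler_wpM2r// ltW.
Qed.

(** * The complex exponential and the mean value argument *)

Definition cexp z : C :=
  cplx (expR (complex.Re z) * cos (complex.Im z)) (expR (complex.Re z) * sin (complex.Im z)).

Lemma cexpD z w : cexp (z + w) = cexp z * cexp w.
Proof.
case: z => a b; case: w => c d; rewrite /cexp /cplx /= expRD cosD sinD.
by apply/eqP; rewrite eq_complex /=; apply/andP; split; apply/eqP; ring.
Qed.

Lemma cmod_cexp z : cmod (cexp z) = expR (complex.Re z).
Proof.
apply/eqP; rewrite -(@eqrXn2 _ 2)// ?cmod_ge0 ?expR_ge0// sqr_cmod/= !exprMn -mulrDr.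
by rewrite cos2Dsin2 mulr1.
Qed.

Lemma cdiff_cexp0 : cdiff cexp 0 1.
Proof.
(* The error splits below into four terms, bounded by [1], [2], [4] and [1] times [e * cmod w];
   their total accounts for the [8]. *)
move=> e' e0'; pose e := Num.min 1 (e' / 8).
have e0 : 0 < e by rewrite lt_min ltr01 divr_gt0.
have [d1 d10 He] := real_linear_approx (is_derive_expR 0) e0.
have [d2 d20 Hc] := real_linear_approx (is_derive_cos 0) e0.
have [d3 d30 Hs] := real_linear_approx (is_derive_sin 0) e0.
exists (Num.min (Num.min d1 d2) (Num.min d3 e)); first by rewrite 3!lt_min d10 d20 d30 e0.
move=> w0; rewrite -(cplx_ReIm w0); move: (complex.Re w0) (complex.Im w0) => a b.
rewrite subr0 3!lt_min => /andP[/andP[h1 h2] /andP[h3 h4]].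
have aw := Re_le_cmod (cplx a b); have bw := Im_le_cmod (cplx a b).
set W := cmod (cplx a b) in h1 h2 h3 h4 aw bw *; rewrite /= in aw bw.
have := He a (le_lt_trans aw h1); have := Hc b (le_lt_trans bw h2).
have := Hs b (le_lt_trans bw h3).
rewrite expR0 sin0 cos0 oppr0 mul0r !subr0 !mul1r ?addr0 => Sb Cb Ea.
have -> : cexp (cplx a b) - cexp 0 - cplx a b =
  cplx ((expR a - 1 - a) * cos b + (1 + a) * (cos b - 1))
       ((expR a - 1) * sin b + (sin b - b)).
  rewrite /cexp /cplx/= expR0 cos0 sin0.
  by apply/eqP; rewrite eq_complex /=; apply/andP; split; apply/eqP; ring.
rewrite (le_trans (cmod_cplx_le _ _))//.
have cb1 : `|cos b| <= 1 by rewrite ler_norml cos_geN1 cos_le1.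
have e1 : e <= 1 by rewrite /e ge_min lexx.
have e8 : e * 8 <= e' by rewrite -ler_pdivlMr// /e ge_min lexx orbT.
have W0 : 0 <= W by exact: cmod_ge0.
have T1 : `|(expR a - 1 - a) * cos b| <= e * W.
  by rewrite normrM -[e * W]mulr1 ler_pM// (le_trans Ea)// ler_pM2l.
have T2 : `|(1 + a) * (cos b - 1)| <= 2 * (e * W).
  rewrite normrM ler_pM//; last by rewrite (le_trans Cb)// ler_pM2l.
  rewrite (le_trans (ler_normD _ _))// normr1 lerD2l.
  by rewrite (le_trans aw)// (le_trans (ltW h4)).
have T4 : `|sin b - b| <= e * W by rewrite (le_trans Sb)// ler_pM2l.
have T3 : `|(expR a - 1) * sin b| <= 4 * (e * W).
  rewrite normrM (_ : 4 * (e * W) = (2 * e) * (2 * W)); last ring.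
  have L (x y k : R) : `|x - y| <= e * k -> `|y| <= k -> `|x| <= 2 * k.
    move=> hx hy; rewrite -[x](subrK y) (le_trans (ler_normD _ _))//.
    have := normr_ge0 y; nra.
  apply: ler_pM => //; last exact: L T4 bw.
  by apply: (L _ a) => //; [apply: (le_trans Ea); rewrite ler_pM2l//|];
    apply: (le_trans aw); apply: ltW.
apply: (le_trans (lerD (ler_normD _ _) (ler_normD _ _))).
apply: (@le_trans _ _ (e * 8 * W)); last by rewrite ler_wpM2r.
move: T1 T2 T3 T4; clear; lra.
Qed.

Lemma cdiff_cexp z : cdiff cexp z (cexp z).
Proof.
move=> e e0; have p0 : 0 < e / cmod (cexp z) by rewrite divr_gt0// cmod_cexp expR_gt0.
have [d d0 H] := cdiff_cexp0 p0; exists d => // w wd.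
have := H (w - z); rewrite !subr0 => /(_ wd).
have c0 : cexp 0 = 1.
  by rewrite /cexp/= expR0 cos0 sin0 mulr1 mulr0.
rewrite c0 mul1r => h.
have -> : cexp w - cexp z - cexp z * (w - z) =
  cexp z * (cexp (w - z) - 1 - (w - z)).
  have -> : cexp w = cexp z * cexp (w - z) by rewrite -cexpD addrC subrK.
  by ring.
rewrite cmodM mulrC -ler_pdivlMr; last by rewrite cmod_cexp expR_gt0.
by rewrite mulrAC.
Qed.

Lemma cdiff_cauchy_riemann (g : C -> C) s t c : cdiff g (cplx s t) c ->
  cauchy_riemann (fun s t => complex.Re (g (cplx s t)))
                 (fun s t => complex.Im (g (cplx s t))) s t.
Proof.
move=> H; exists (complex.Re c), (complex.Im c).
have K (e : R) : 0 < e -> exists2 del : R, 0 < del & forall s' t' : R,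
    `|s' - s| < del -> `|t' - t| < del ->
    cmod (g (cplx s' t') - g (cplx s t) - c * cplx (s' - s) (t' - t)) <=
       e * (`|s' - s| + `|t' - t|).
  move=> e0; have [d d0 {}H] := H e e0; exists (d / 2); first by rewrite divr_gt0.
  move=> s' t' hs ht.
  have hle : cmod (cplx s' t' - cplx s t) <= `|s' - s| + `|t' - t|.
    exact: (cmod_cplx_le (s' - s) (t' - t)).
  apply: (le_trans (H (cplx s' t') _)); last by rewrite ler_pM2l.
  by rewrite (le_lt_trans hle)// [d]splitr ltrD.
by split=> e /K[d d0 Hd]; exists d => // s' t' hs ht; apply: le_trans (Hd _ _ hs ht);
  [rewrite (le_trans _ (Re_le_cmod _))//|rewrite (le_trans _ (Im_le_cmod _))//];
  case: (g (cplx s' t')) => x y; case: (g (cplx s t)) => x' y'; case: (c) => A B /=;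
  rewrite le_eqVlt; apply/orP; left; apply/eqP; congr `|_|; ring.
Qed.

(* Goursat's theorem for [f (p + exp (s + it))] on [s0, s1] x [0, 2 pi], whose
   horizontal sides cancel by periodicity, makes the mean of [Re f] over the
   circle of radius [exp s] around [p] independent of [s]; only continuity is
   needed at [p]. *)
Lemma no_strict_local_max (f : C -> C) (p : C) (r e : R) : 0 < r -> 0 < e ->
  {for p, continuous f} ->
  (forall z, z != p -> cmod (z - p) < r -> derivable f z 1) ->
  (forall z, cmod (z - p) < r ->
     complex.Re (f z) <= complex.Re (f p) - e * cmod (z - p) ^+ 2) -> False.
Proof.
move=> r0 e0 fc fd fM.
pose g z := f (p + cexp z).
pose u s t := complex.Re (g (cplx s t)); pose v s t := complex.Im (g (cplx s t)).
have pc w : p + cexp w - p = cexp w by rewrite addrC addKr.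
have gd s t : expR s < r -> cauchy_riemann u v s t.
  move=> sr; have [|c Hc] := @derivable_cdiff f (p + cexp (cplx s t)).
    apply: fd; last by rewrite pc cmod_cexp.
    by rewrite -subr_eq0 pc -cmod_gt0 cmod_cexp expR_gt0.
  apply: (@cdiff_cauchy_riemann g _ _ (c * cexp (cplx s t))).
  apply: (@cdiff_comp (fun z => p + cexp z) f) => // e1 e10.
  have [d d0 H] := cdiff_cexp (cplx s t) e10.
  by exists d => // w /H; rewrite (_ : p + cexp w - _ = cexp w - cexp (cplx s t)) //; ring.
(* On the outer circle, of radius [r / 2], the real part is at most [Re (f p) - K]; the inner radius
   [r0'] is chosen by continuity at [p] so that it stays above [Re (f p) - K / 2] there. Equal means
   are then impossible. *)
pose K := e * (r / 2) ^+ 2.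
have K0 : 0 < K by rewrite mulr_gt0// exprn_gt0// divr_gt0.
have /continuousCP/(_ _ (divr_gt0 K0 (ltr0n _ 2)))[d d0 Hd] := fc.
pose r0' := Num.min (r / 4) (d / 2).
have r0'0 : 0 < r0' by rewrite lt_min !divr_gt0.
pose s0 := ln r0'; pose s1 := ln (r / 2).
have es0 : expR s0 = r0' by rewrite lnK.
have es1 : expR s1 = r / 2 by rewrite lnK// posrE divr_gt0.
have s01 : s0 < s1.
  by rewrite -ltr_expR es0 es1 /r0' gt_min; apply/orP; left; lra.
have pi20 : (0 : R) < pi * 2 by rewrite mulr_gt0 ?pi_gt0.
have CR s t : s0 <= s <= s1 -> 0 <= t <= pi * 2 -> cauchy_riemann u v s t.
  move=> /andP[_ ss] _; apply: gd; apply: (@le_lt_trans _ _ (expR s1)).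
    by rewrite ler_expR.
  by rewrite es1 gtr_pMr// invf_lt1// ltr1n.
have := goursat CR s01 pi20; rewrite /flux.
have -> : (fun s => v s (pi * 2) - v s 0) = fun=> 0.
  by apply/funext => s; rewrite /v /g /cexp/= mulr_natr cos2pi sin2pi cos0 sin0 subrr.
rewrite itv_integral_cst ?(ltW s01)// mul0r subr0 => E.
have cont s : s0 <= s <= s1 -> cont_on (u s) 0 (pi * 2) by exact: (CR_contu CR).
have : itv_integral (fun t => u s1 t - u s0 t) 0 (pi * 2) <=
       itv_integral (fun=> - (K / 2)) 0 (pi * 2).
  apply: le_itv_integral; last first.
  - move=> t _.
    have h1 : u s1 t <= complex.Re (f p) - K.
      have /= := fM (p + cexp (cplx s1 t)); rewrite pc cmod_cexp/= es1; apply.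
      by rewrite gtr_pMr// invf_lt1// ltr1n.
    have h2 : complex.Re (f p) - K / 2 <= u s0 t.
      have := Hd (p + cexp (cplx s0 t)); rewrite pc cmod_cexp/= es0.
      have r0d : r0' < d by rewrite /r0' gt_min; apply/orP; right; lra.
      move=> /(_ r0d) h; have := le_lt_trans (Re_le_cmod _) h.
      rewrite /u /g raddfB/= ltr_norml => /andP[+ _]; clear; lra.
    by move: h1 h2; clear; lra.
  - exact: cont_on_cst.
  - by apply: cont_onB; apply: cont; rewrite lexx ltW.
rewrite E itv_integral_cst ?(ltW pi20)// subr0; apply/negP; rewrite -ltNge.
by rewrite mulNr oppr_lt0 mulr_gt0// divr_gt0.
Qed.

End ComplexPlane.

(** * Maximum modulus principle and Schwarz lemma *)

Section MaximumModulus.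
Variable R : realType.
Local Notation C := (Cplx R).
Implicit Types (z w : C) (x y : R).

Lemma Re_conjM z w : complex.Re (z^* * w) =
  complex.Re z * complex.Re w + complex.Im z * complex.Im w.
Proof. by case: z w => a b [c d] /=; rewrite mulNr opprK. Qed.

Lemma sqr_cmodD z w :
  cmod (z + w) ^+ 2 = cmod z ^+ 2 + 2 * complex.Re (z^* * w) + cmod w ^+ 2.
Proof. by rewrite Re_conjM !sqr_cmod; case: z w => a b [c d] /=; ring. Qed.

Lemma cmod_continuous : continuous (@cmod R).
Proof.
move=> z P /nbhs_ballP[e /= e0 HP]; apply/nbhsCP; exists e => // w hw.
apply: HP; rewrite /ball/=.
apply: le_lt_trans hw.
have h1 : cmod z <= cmod w + cmod (w - z).
  by rewrite cmodB -[X in cmod X <= _](subrK w z) addrC (le_trans (cmodD _ _)).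
have h2 : cmod w <= cmod z + cmod (w - z).
  by rewrite -[X in cmod X <= _](subrK z w) addrC (le_trans (cmodD _ _)).
by rewrite ler_norml; apply/andP; split; move: h1 h2; clear; lra.
Qed.

Lemma continuous_cmod (T : topologicalType) (f : T -> C) t :
  {for t, continuous f} -> {for t, continuous (fun t => cmod (f t))}.
Proof. by move=> fc; apply: continuous_comp; [exact: fc|exact: cmod_continuous]. Qed.

Lemma continuous_cplx : continuous (fun p : R * R => cplx p.1 p.2 : C).
Proof.
move=> [x y] P /nbhsCP[e e0 HP].
have e2 : 0 < e / 2 by rewrite divr_gt0.
exists (ball x (e / 2), ball y (e / 2)); first by split; exact: nbhsx_ballx.
move=> [x' y'] [/= + +]; rewrite /ball/= => h1 h2; apply: HP.
apply: (le_lt_trans (cmod_cplx_le (x' - x) (y' - y))).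
by rewrite [e]splitr ltrD// distrC.
Qed.

Section C_valued_continuous.
Variables (T : topologicalType) (f g : T -> C) (t : T).
Hypotheses (fc : {for t, continuous f}) (gc : {for t, continuous g}).

Lemma contD : {for t, continuous (fun t => f t + g t)}.
Proof. exact: (cvgD fc gc). Qed.
Lemma contB : {for t, continuous (fun t => f t - g t)}.
Proof. exact: (cvgB fc gc). Qed.
Lemma contM : {for t, continuous (fun t => f t * g t)}.
Proof. exact: (cvgM fc gc). Qed.
Lemma contX n : {for t, continuous (fun t => f t ^+ n)}.
Proof.
elim: n => [|n IH]; first exact: cvg_cst.
rewrite (_ : (fun t => f t ^+ n.+1) = fun t => f t * f t ^+ n).
  exact: (cvgM fc IH).
by apply/funext => z; rewrite exprS.
Qed.
End C_valued_continuous.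

Lemma contC (T : topologicalType) (k : C) (t : T) : {for t, continuous (fun=> k)}.
Proof. exact: (@cst_continuous _ _ k t). Qed.

Arguments contC {T} k t.

Lemma contId (t : C) : {for t, continuous (fun z : C => z)}.
Proof. by move=> P. Qed.
Arguments contId t : clear implicits.

Section C_derivable.
Variables (f g : C -> C) (z : C).
Hypotheses (fd : derivable f z 1) (gd : derivable g z 1).

Lemma derD : derivable (fun z => f z + g z) z 1.
Proof. exact: (derivableD fd gd). Qed.
Lemma derB : derivable (fun z => f z - g z) z 1.
Proof. exact: (derivableB fd gd). Qed.
Lemma derM : derivable (fun z => f z * g z) z 1.
Proof. exact: (derivableM fd gd). Qed.
Lemma derV : f z != 0 -> derivable (fun z => (f z)^-1) z 1.
Proof. by move=> f0; exact: (derivableV f0 fd). Qed.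
End C_derivable.

Lemma derC (k z : C) : derivable (fun=> k : C) z 1.
Proof. exact: (derivable_cst k z 1). Qed.
Arguments derC k z : clear implicits.

Lemma derId (z : C) : derivable (fun z : C => z) z 1.
Proof.
apply: (@cdiff_derivable _ _ _ 1) => e e0; exists 1 => // w _.
by rewrite mul1r subrr cmod0 mulr_ge0 ?cmod_ge0 ?ltW.
Qed.
Arguments derId z : clear implicits.

Lemma derivable_continuous_at (f : C -> C) z :
  derivable f z 1 -> {for z, continuous f}.
Proof.
move=> /derivable_cdiff[c Hc]; apply/continuousCP => e e0.
have [d d0 Hd] := Hc 1 ltr01.
have c1 : 0 < cmod c + 1 by rewrite ltr_wpDl ?cmod_ge0.
exists (Num.min d (e / (cmod c + 1))); first by rewrite lt_min d0 divr_gt0.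
move=> w; rewrite lt_min => /andP[wd we].
rewrite -[f w - f z](subrK (c * (w - z))) (le_lt_trans (cmodD _ _))//.
apply: (@le_lt_trans _ _ ((cmod c + 1) * cmod (w - z))).
  by rewrite cmodM mulrDl addrC lerD2l; exact: Hd.
by rewrite mulrC -ltr_pdivlMr.
Qed.

Lemma compact_cmod (P : set R) (D : R) : closed P -> P `<=` [set x | x <= D] ->
  compact [set z : C | P (cmod z)].
Proof.
move=> Pc PD; pose B := (fun p : R * R => cplx p.1 p.2 : C) @` (`[-D, D] `*` `[-D, D]).
apply: (@subclosed_compact _ _ B).
- by apply: (@preimage_closed _ _ (@cmod R)) => // z _; exact: cmod_continuous.
- apply: continuous_compact.
    by apply: continuous_subspaceT; exact: continuous_cplx.
  by apply: compact_setX; exact: segment_compact.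
- move=> z /PD /= zD; exists (complex.Re z, complex.Im z); last exact: cplx_ReIm.
  by split; rewrite /= in_itv/= -ler_norml (le_trans _ zD)// ?Re_le_cmod ?Im_le_cmod.
Qed.

(* The maximum of [|f|^2 + e |z|^2] on [K] is attained near the boundary: at an
   interior maximum [p], expanding the squares around [p] bounds the real part
   of the holomorphic function [H] above by [- e / 2 * |z - p|^2], which contradicts
   [no_strict_local_max]. *)
Lemma max_modulus (K B : set C) (f : C -> C) (b : C) (M : R) : compact K ->
  (forall z, K z -> {for z, continuous f}) ->
  (forall z, K z -> z != b -> derivable f z 1) ->
  (forall z, K z -> B z \/ nbhs z K) -> 0 <= M ->
  (forall z, K z -> B z -> cmod (f z) <= M) ->
  forall z, K z -> cmod (f z) <= M.
Proof.
move=> Kc fc fd KB M0 fM z0 Kz0; rewrite leNgt; apply/negP => Mz0.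
have K0 : K !=set0 by exists z0.
have cK (g : C -> R) : (forall z, K z -> {for z, continuous g}) -> {within K, continuous g}.
  by move=> gc; apply: continuous_in_subspaceT => z; rewrite inE; exact: gc.
have [d _ Hd] := compact_EVT_max K0 Kc (cK _ (fun z _ => @cmod_continuous z)).
pose D := cmod d + 1.
have D0 : 0 < D by rewrite ltr_wpDl ?cmod_ge0.
have KD z : K z -> cmod z <= D.
  by move=> Kz; rewrite (le_trans (Hd z _)) ?inE// lerDl.
(* With this [e] the added term is at most half of [cmod (f z0) ^+ 2 - M ^+ 2] on [K], so no point
   of [B] reaches the value at [z0]. *)
pose e := (cmod (f z0) ^+ 2 - M ^+ 2) / (2 * D ^+ 2).
have e0 : 0 < e.
  rewrite divr_gt0 ?mulr_gt0 ?exprn_gt0// subr_gt0 ltr_sqr ?nnegrE//.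
  exact: cmod_ge0.
pose Phi z := cmod (f z) ^+ 2 + e * cmod z ^+ 2.
have Phic z : K z -> {for z, continuous Phi}.
  move=> Kz; have h1 := continuous_cmod (fc z Kz).
  have h2 : {for z, continuous (@cmod R)} by exact: cmod_continuous.
  have := cvgD (cvgM h1 h1) (cvgM (cvg_cst e) (cvgM h2 h2)); exact.
have [p] := compact_EVT_max K0 Kc (cK _ Phic); rewrite inE => Kp Hp.
have {}Hp z : K z -> Phi z <= Phi p by move=> Kz; apply: Hp; rewrite inE.
have : nbhs p K.
  have [Bp|//] := KB p Kp; exfalso.
  have := Hp z0 Kz0; apply/negP; rewrite -ltNge /Phi.
  apply: (@lt_le_trans _ _ (cmod (f z0) ^+ 2)); last first.
    by rewrite lerDl mulr_ge0 ?(ltW e0)// sqr_ge0.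
  apply: (@le_lt_trans _ _ (M ^+ 2 + e * D ^+ 2)).
    by apply: lerD; [|rewrite ler_pM2l//]; rewrite ler_sqr ?nnegrE ?cmod_ge0// ?(ltW D0)// ?fM// KD.
  have -> : e * D ^+ 2 = (cmod (f z0) ^+ 2 - M ^+ 2) / 2.
    by rewrite /e; field; rewrite gt_eqF.
  have : M ^+ 2 < cmod (f z0) ^+ 2 by rewrite ltr_sqr ?nnegrE ?cmod_ge0.
  by clear; lra.
move=> /nbhsCP[r r0 Hr].
(* The exceptional point [b] is kept out of the punctured disc around [p]; if it is [p] itself, it
   is the centre, where continuity is enough. *)
have [r' [r'0 r'r pb]] : exists r', [/\ 0 < r', r' <= r &
    forall z, z != p -> cmod (z - p) < r' -> z != b].
  have [->|pb] := eqVneq p b; first by exists r.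
  exists (Num.min r (cmod (b - p))); split.
  - by rewrite lt_min r0 cmod_gt0 subr_eq0 eq_sym.
  - by rewrite ge_min lexx.
  - by move=> z _; rewrite lt_min => /andP[_]; apply: contraTneq => ->; rewrite ltxx.
pose H z := (f p)^* * (f z - f p) + realC e * p^* * (z - p).
apply: (@no_strict_local_max R H p r' (e / 2)) => //.
- by rewrite divr_gt0.
- have fp := fc p Kp.
  exact: (contD (contM (contC (f p)^* p) (contB fp (contC (f p) p)))
     (contM (contC (realC e * p^* ) p) (contB (contId p) (contC (p : C) p)))).
- move=> z zp zr.
  have fz : derivable f z 1.
    by apply: fd; [apply: Hr; exact: lt_le_trans r'r|exact: (pb z)].
  exact: (derD (derM (derC (f p)^* z) (derB fz (derC (f p) z)))
     (derM (derC (realC e * p^* ) z) (derB (derId z) (derC (p : C) z)))).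
- move=> z zr; have Kz : K z by apply: Hr; exact: lt_le_trans r'r.
  have := Hp z Kz; rewrite /Phi -[in cmod (f z)](subrK (f p) (f z)) [f z - f p + _]addrC.
  rewrite -[in cmod z](subrK p z) [z - p + p]addrC (sqr_cmodD (f p)) (sqr_cmodD p).
  have := sqr_ge0 (cmod (f z - f p)).
  have -> : complex.Re (H z) = complex.Re ((f p)^* * (f z - f p)) +
      e * complex.Re (p^* * (z - p)).
    rewrite /H -mulrA raddfD/=; congr (_ + _).
    by case: (p^* * (z - p)) => x y /=; rewrite mul0r subr0.
  have -> : complex.Re (H p) = 0 by rewrite /H !subrr !mulr0 addr0.
  by clear; lra.
Qed.

(** The quotient [(F z - F b) / (z - b)], continued by the derivative at [b], is multiplied by
    [1 - b^* * z]. On a circle close enough to the unit circle this factor is at most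
    [2 * cmod (z - b)], and [F z - F b] is at most [2 * M]; the maximum principle carries the
    product [4 * M] to [a]. Accepting a constant larger than the sharp one allows one fixed circle
    instead of a limit of radii. *)
Lemma schwarz_bound (F : C -> C) (M : R) (a b : C) : 0 <= M ->
  (forall t, cmod t < 1 -> derivable F t 1) ->
  (forall t, cmod t < 1 -> cmod (F t) <= M) ->
  cmod a < 1 -> cmod b < 1 ->
  cmod (F a - F b) <= 4 * M * (cmod (a - b) / cmod (1 - b^* * a)).
Proof.
move=> M0 Fd FM a1 b1.
have [->|ab] := eqVneq a b; first by rewrite !subrr !cmod0 mul0r mulr0.
have [c Hc] := derivable_cdiff (Fd b b1).
pose q0 z : C := if z == b then c else (F z - F b) / (z - b).
pose q z := q0 z * (1 - b^* * z).
have q0d z : cmod z < 1 -> z != b -> derivable q0 z 1.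
  move=> z1 zb; have zb0 : z - b != 0 by rewrite subr_eq0.
  have := derM (derB (Fd z z1) (derC (F b) z)) (derV (derB (derId z) (derC b z)) zb0).
  apply: near_eq_derivable; apply/nbhsCP; exists (cmod (b - z)).
    by rewrite cmod_gt0 subr_eq0 eq_sym.
  move=> w wz; rewrite /q0 ifF//; apply/negP => /eqP wb.
  by move: wz; rewrite wb ltxx.
have q0c z : cmod z < 1 -> {for z, continuous q0}.
  move=> z1; have [->|zb] := eqVneq z b; last exact: derivable_continuous_at (q0d z z1 zb).
  apply/continuousCP => e e0; have [d d0 Hd] := Hc _ (divr_gt0 e0 (ltr0n _ 2)).
  exists d => // w wd; rewrite /q0 eqxx; have [_|wb] := eqVneq w b.
    by rewrite subrr cmod0.
  have := Hd w wd; have wb0 : w - b != 0 by rewrite subr_eq0.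
  have -> : F w - F b - c * (w - b) = ((F w - F b) / (w - b) - c) * (w - b) by field.
  rewrite cmodM ler_pM2r ?cmod_gt0// => /le_lt_trans; apply.
  by rewrite ltr_pdivrMr// ltr_pMr// ltr1n.
have nz z : cmod z < 1 -> 1 - b^* * z != 0.
  move=> z1; rewrite subr_eq0; apply/eqP => E.
  have := cmod1 R; rewrite E cmodM cmod_conj => E1.
  have := cmod_ge0 b; have := cmod_ge0 z; move: z1 b1 E1; clear; nra.
suff qa : cmod (q a) <= 4 * M.
  rewrite mulrA ler_pdivlMr ?cmod_gt0 ?nz//.
  have -> : cmod (F a - F b) * cmod (1 - b^* * a) = cmod (q a) * cmod (a - b).
    rewrite -!cmodM /q /q0 (negPf ab); congr cmod; field.
    by rewrite subr_eq0.
  by rewrite ler_wpM2r ?cmod_ge0.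
(* The circle of radius [rho = 1 - de] must enclose [a], stay at distance at least [ga / 2] from
   [b], and satisfy [1 - rho ^+ 2 <= 3 * (ga / 2) ^+ 2]. The last condition turns the identity for
   [cmod (1 - b^* * z) ^+ 2] into the bound by [4 * cmod (z - b) ^+ 2]. *)
pose ga := 1 - cmod b; pose de := Num.min (ga ^+ 2 / 4) ((1 - cmod a) / 2).
have ga0 : 0 < ga by rewrite subr_gt0.
have ga1 : ga <= 1 by rewrite lerBlDr lerDl cmod_ge0.
have de0 : 0 < de by rewrite lt_min !divr_gt0 ?exprn_gt0// subr_gt0.
have deg : de <= ga ^+ 2 / 4 by rewrite ge_min lexx.
have dea : de <= (1 - cmod a) / 2 by rewrite ge_min lexx orbT.
pose rho := 1 - de.
have gaq : ga ^+ 2 <= ga by rewrite expr2 ler_piMr// ltW.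
have rb : ga / 2 <= rho - cmod b.
  by rewrite /rho; move: deg gaq ga0; rewrite /ga; clear; lra.
have rho1 : rho < 1 by rewrite gtrBl.
have rho0 : 0 <= rho by have := cmod_ge0 b; move: rb ga0; clear; lra.
have ra : cmod a <= rho by move: dea a1; rewrite /rho; clear; lra.
have rq : 1 - rho ^+ 2 <= 3 * (ga / 2) ^+ 2.
  have -> : 1 - rho ^+ 2 = 2 * de - de ^+ 2 by rewrite /rho; ring.
  have := sqr_ge0 de; move: deg (sqr_ge0 ga); rewrite exprMn; clear; lra.
apply: (@max_modulus [set z | cmod z <= rho] [set z | cmod z = rho] q b) => //.
- by apply: (@compact_cmod [set x | x <= rho] rho) => //; exact: closed_le.
- move=> z /= zr; have z1 := le_lt_trans zr rho1.
  exact: (contM (q0c z z1) (contB (contC 1 z) (contM (contC b^* z) (contId z)))).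
- move=> z /= zr zb; have z1 := le_lt_trans zr rho1.
  exact: (derM (q0d z z1 zb) (derB (derC 1 z) (derM (derC b^* z) (derId z)))).
- move=> z /=; rewrite le_eqVlt => /predU1P[->|zr]; first by left.
  right; apply/nbhsCP; exists (rho - cmod z); first by rewrite subr_gt0.
  move=> w wz /=; rewrite -[w](subrK z) (le_trans (cmodD _ _))// -lerBrDr.
  exact: ltW.
- by rewrite mulr_ge0.
- move=> z _ /= zr; have z1 : cmod z < 1 by rewrite zr.
  have zb : ga / 2 <= cmod (z - b).
    apply: (le_trans rb); rewrite -zr lerBlDr.
    by rewrite -[X in cmod X <= _](subrK b z) cmodD.
  have zb' : z != b by rewrite -subr_eq0 -cmod_gt0 (lt_le_trans _ zb)// divr_gt0.
  rewrite /q /q0 (negPf zb').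
  have h1 : cmod (1 - b^* * z) <= 2 * cmod (z - b).
    rewrite -ler_sqr ?nnegrE ?mulr_ge0 ?cmod_ge0//.
    have -> : cmod (1 - b^* * z) ^+ 2 = cmod (z - b) ^+ 2 +
       (1 - cmod z ^+ 2) * (1 - cmod b ^+ 2).
      by rewrite !sqr_cmod; case: (z) => x y; case: (b) => x' y' /=; ring.
    have : (ga / 2) ^+ 2 <= cmod (z - b) ^+ 2.
      by rewrite ler_sqr ?nnegrE ?cmod_ge0// ?divr_ge0// ltW.
    have : (1 - cmod z ^+ 2) * (1 - cmod b ^+ 2) <= 1 - rho ^+ 2.
      rewrite zr ler_piMr//; last by rewrite lerBlDr lerDl sqr_ge0.
      by rewrite subr_ge0 expr_le1// ltW.
    rewrite exprMn; move: rq; clear; lra.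
  have h2 : cmod (F z - F b) <= 2 * M.
    rewrite (le_trans (cmodD _ _))// cmodN mulr_natl mulr2n lerD// FM//.
  rewrite !cmodM cmodV mulrAC ler_pdivrMr; last by rewrite cmod_gt0 subr_eq0.
  apply: (le_trans (ler_pM _ _ h2 h1)); rewrite ?cmod_ge0//.
  by rewrite le_eqVlt; apply/orP; left; apply/eqP; ring.
Qed.

(** Since [1 - d <= expR (- d)], one has [expR d * (1 - d) <= 1 <= 1 + d]. With [schwarz_bound] this
    makes bounded holomorphic functions Lipschitz for the Poincaré distance. *)
Lemma poincare_dist_ge (a b : C) : cmod a < 1 -> cmod b < 1 ->
  cmod (a - b) / cmod (1 - b^* * a) <= poincare_dist a b.
Proof.
move=> a1 b1; rewrite /poincare_dist.
set d := complex.Re _.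
have dE : d = cmod (a - b) / cmod (1 - b^* * a).
  apply: realC_inj; rewrite realCM realCV -!normcE /d /realC.
  by rewrite RRe_real// rpred_div ?normr_real.
have E : cmod (1 - b^* * a) ^+ 2 = cmod (a - b) ^+ 2 +
       (1 - cmod a ^+ 2) * (1 - cmod b ^+ 2).
  by rewrite !sqr_cmod; case: (a) => x y; case: (b) => x' y' /=; ring.
have lt1 : cmod (a - b) < cmod (1 - b^* * a).
  rewrite -ltr_sqr ?nnegrE ?cmod_ge0// E ltrDl mulr_gt0// subr_gt0 expr_lt1// cmod_ge0//.
have den0 : 0 < cmod (1 - b^* * a) by rewrite (le_lt_trans _ lt1)// cmod_ge0.
have d1 : d < 1 by rewrite dE ltr_pdivrMr// mul1r.
have d0 : 0 <= d by rewrite dE divr_ge0 ?cmod_ge0.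
rewrite -dE -[leLHS]expRK ler_ln ?posrE ?expR_gt0//; last first.
  by rewrite divr_gt0// ?subr_gt0// ltr_pwDl.
have := expR_ge1Dx (- d); rewrite expRN => h.
rewrite ler_pdivlMr ?subr_gt0//.
have e0 := expR_gt0 d.
apply: (@le_trans _ _ 1); last by rewrite lerDl.
by rewrite mulrC -ler_pdivlMr// mul1r.
Qed.

End MaximumModulus.
Arguments contC {R T} k t.
Arguments contId {R} t.
Arguments derC {R} k z.
Arguments derId {R} z.

(** * Mostow decomposition *)

Section Mostow.
Variable R : realType.
Local Notation C := (Cplx R).
Implicit Types (g u : 'M[C]_2) (h x y : R).

Lemma mx2P g g' : g 0 0 = g' 0 0 -> g 0 1 = g' 0 1 -> g 1 0 = g' 1 0 ->
  g 1 1 = g' 1 1 -> g = g'.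
Proof.
move=> h1 h2 h3 h4; apply/matrixP => -[[|[|//]] i] [[|[|//]] k].
- by move: h1; congr (_ = _); congr (fun_of_matrix _ _ _); apply: val_inj.
- by move: h2; congr (_ = _); congr (fun_of_matrix _ _ _); apply: val_inj.
- by move: h3; congr (_ = _); congr (fun_of_matrix _ _ _); apply: val_inj.
- by move: h4; congr (_ = _); congr (fun_of_matrix _ _ _); apply: val_inj.
Qed.

Lemma mulmx2E g g' i j : (g *m g') i j = g i 0 * g' 0 j + g i 1 * g' 1 j.
Proof.
rewrite mxE !big_ord_recl big_ord0 addr0; do !congr (_ + _).
by congr (g _ _ * g' _ _); apply: val_inj.
Qed.

Lemma mx2_00 (a b c d : C) : mx2 a b c d 0 0 = a. Proof. by rewrite mxE. Qed.
Lemma mx2_01 (a b c d : C) : mx2 a b c d 0 1 = b. Proof. by rewrite mxE. Qed.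
Lemma mx2_10 (a b c d : C) : mx2 a b c d 1 0 = c. Proof. by rewrite mxE. Qed.
Lemma mx2_11 (a b c d : C) : mx2 a b c d 1 1 = d. Proof. by rewrite mxE. Qed.
Definition mx2s := (mx2_00, mx2_01, mx2_10, mx2_11).

Lemma det_mx2 g : \det g = g 0 0 * g 1 1 - g 0 1 * g 1 0.
Proof.
have e1 : lift ord0 ord0 = 1 :> 'I_2 by exact: val_inj.
have e2 : lift 1 0 = 0 :> 'I_2 by exact: val_inj.
rewrite (expand_det_row _ 0) !big_ord_recl big_ord0 addr0 /cofactor !det_mx11 !mxE e1 /= e2.
by rewrite !add0n /bump/= expr0 expr1 mul1r mulN1r mulrN.
Qed.

(** The matrix [x + y (iH)]. As [(iH)^2 = 1], these matrices multiply like split-complex numbers,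
    and [exp (ihH)] is the one with coordinates [cosh h] and [sinh h]. *)
Definition hyp (x y : R) : 'M[C]_2 :=
  mx2 (realC x) (- 'i * realC y) ('i * realC y) (realC x).

Lemma hypM x y x' y' : hyp x y *m hyp x' y' = hyp (x * x' + y * y') (x * y' + y * x').
Proof.
by apply: mx2P; rewrite mulmx2E !mx2s !realCD !realCM; have := sqrCi C;
  move: ('i : C) => I hI; ring: hI.
Qed.

Lemma hyp10 : hyp 1 0 = 1%:M.
Proof. by apply: mx2P; rewrite /hyp !mx2s !mxE/= ?mulr0. Qed.

Local Open Scope sesquilinear_scope.

Lemma hyp_adj x y : (hyp x y)^t* = hyp x y.
Proof.
apply: mx2P; rewrite !mxE /= ?conj_realC// rmorphM/= ?rmorphN /= conjCi ?opprK;
by rewrite conj_realC.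
Qed.

Lemma hypX h n : (hyp 0 h) ^+ n =
  hyp ((h ^+ n + (- h) ^+ n) / 2) ((h ^+ n - (- h) ^+ n) / 2).
Proof.
elim: n => [|n IH].
  by rewrite !expr0 subrr mul0r (_ : (1 + 1) / 2 = 1) ?hyp10//; field.
by rewrite exprS IH [_ * _]hypM !mul0r !add0r !exprS; congr hyp; field.
Qed.

Lemma hypD x y x' y' : hyp x y + hyp x' y' = hyp (x + x') (y + y').
Proof. by apply: mx2P; rewrite !mxE /= !realCD; ring. Qed.

Lemma hypZ k x y : realC k *: hyp x y = hyp (k * x) (k * y).
Proof. by apply: mx2P; rewrite !mxE /= !realCM; ring. Qed.

Lemma cvg_realC (u : R^nat) (l : R) : u @ \oo --> l ->
  (fun n => realC (u n)) @ \oo --> (realC l : C).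
Proof.
move=> ul P /nbhsCP[d d0 HP]; move/cvgrPdist_lt : ul => /(_ d d0)[N _ HN].
exists N => // n Nn; apply: HP.
by rewrite -realCB cmod_realC distrC; exact: HN.
Qed.

(** The partial sums remain of the form [hyp]: their coordinates are the half sum and half
    difference of the partial sums of the real exponential series at [h] and [- h]. *)
Lemma expmx_hyp h : expmx (('i * realC h) *: Hmx R) =
  hyp ((expR h + expR (- h)) / 2) ((expR h - expR (- h)) / 2).
Proof.
have -> : ('i * realC h) *: Hmx R = hyp 0 h.
  by apply: mx2P; rewrite !mxE /= ?mulr0 ?mulr1 ?mulrN1 ?mulNr.
pose s (x : R) := series (exp_coeff x).
rewrite /expmx (_ : series _ = (fun n => hyp ((s h n + s (- h) n) / 2)
   ((s h n - s (- h) n) / 2))); last first.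
  apply/funext => n; rewrite /s /series/=.
  elim: n => [|n IH].
    by rewrite !big_geq// addr0 subr0 mul0r -[LHS](scale0r (hyp 0 0)) -realC0 hypZ !mul0r.
  rewrite !big_nat_recr//= IH hypX.
  have -> : (n`!%:R : C)^-1 = realC (n`!%:R)^-1.
    by rewrite realCV; congr (_^-1); rewrite /realC rmorph_nat.
  by rewrite hypZ hypD /exp_coeff/=; congr hyp; ring.
have sc (x : R) : s x @ \oo --> expR x by exact: is_cvg_series_exp_coeff.
pose p n := (s h n + s (- h) n) / 2; pose q n := (s h n - s (- h) n) / 2.
have pc : p @ \oo --> (expR h + expR (- h)) / 2.
  exact: cvgMr_tmp (cvgD (sc h) (sc (- h))).
have qc : q @ \oo --> (expR h - expR (- h)) / 2.
  exact: cvgMr_tmp (cvgB (sc h) (sc (- h))).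
apply/cvg_lim; first exact: norm_hausdorff.
have hE (x y : R) : hyp x y = realC x *: 1%:M + realC y *: hyp 0 1.
  by rewrite -hyp10 !hypZ hypD !mulr0 !mulr1 add0r addr0.
rewrite hE; under eq_fun do rewrite hE.
apply: cvgD; apply: cvgZr_tmp; exact: cvg_realC.
Qed.

(** * Column norms and existence of the decomposition *)

Definition colsq g j : R := cmod (g 0 j) ^+ 2 + cmod (g 1 j) ^+ 2.

Lemma realC_sqr_cmod (z : C) : realC (cmod z ^+ 2) = z^* * z.
Proof. by rewrite realCX -normcE mulrC normCK. Qed.

Lemma gramE g i j : (g^t* *m g) i j = (g 0 i)^* * g 0 j + (g 1 i)^* * g 1 j.
Proof. by rewrite mulmx2E !mxE. Qed.

Lemma colsq_gram g j : realC (colsq g j) = (g^t* *m g) j j.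
Proof. by rewrite gramE realCD !realC_sqr_cmod. Qed.

Lemma gram_unitary u g : u \is unitarymx -> (u *m g)^t* *m (u *m g) = g^t* *m g.
Proof.
move=> /unitarymxP/mulmx1C uu.
by rewrite trmx_mul map_mxM !mulmxA -(mulmxA _ (u^t*)) uu mulmx1.
Qed.

Lemma colsq_unitary u g j : u \is unitarymx -> colsq (u *m g) j = colsq g j.
Proof. by move=> uU; apply: realC_inj; rewrite !colsq_gram gram_unitary. Qed.

Lemma colsq_torus g (k : C) : k != 0 ->
  colsq (g *m torus k) 0 = colsq g 0 * cmod k ^+ 2 /\
  colsq (g *m torus k) 1 = colsq g 1 / cmod k ^+ 2.
Proof.
move=> k0; rewrite /colsq !mulmx2E !mx2s !mulr0 !addr0 !add0r !cmodM cmodV.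
by split; rewrite !exprMn ?exprVn mulrDl.
Qed.

(** The determinant of the Gram matrix is [|det g|^2]. For determinant [1] the product of the
    squared column norms is thus at least [1], the range where [hX] is meaningful. *)
Lemma lagrange_identity g :
  colsq g 0 * colsq g 1 = cmod ((g^t* *m g) 0 1) ^+ 2 + cmod (\det g) ^+ 2.
Proof.
rewrite /colsq gramE det_mx2 !sqr_cmod.
case: (g 0 0) => a b; case: (g 0 1) => c d; case: (g 1 0) => a' b'; case: (g 1 1) => c' d' /=.
ring.
Qed.

Definition sinh (h : R) := (expR h - expR (- h)) / 2.

Lemma expRNK h : expR h * expR (- h) = 1.
Proof. by rewrite -expRD subrr expR0. Qed.

Lemma cosh2_sinh2 h : cosh h ^+ 2 - sinh h ^+ 2 = 1.
Proof. by rewrite /cosh /sinh -[RHS](expRNK h); field. Qed.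

Lemma cosh_double h : cosh (2 * h) = cosh h ^+ 2 + sinh h ^+ 2.
Proof. by rewrite /cosh /sinh -mulrN !expRM_natl; field. Qed.

Lemma sinh_double h : sinh (2 * h) = 2 * (cosh h * sinh h).
Proof. by rewrite /cosh /sinh -mulrN !expRM_natl; field. Qed.

Lemma cosh_ge1 h : 1 <= cosh h.
Proof.
have := expRNK h; have := expR_gt0 h; have := sqr_ge0 (expR h - expR (- h)).
have := expR_gt0 (- h); rewrite /cosh; move: (expR h) (expR (- h)) => x y; nra.
Qed.

Lemma coshN h : cosh (- h) = cosh h. Proof. by rewrite /cosh opprK addrC. Qed.

(** As an equation in [expR h], [cosh h = cosh h'] is quadratic with roots [expR h'] and
    [expR (- h')]. *)
Lemma cosh_inj h h' : cosh h = cosh h' -> h = h' \/ h = - h'.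
Proof.
move=> E; have := expRNK h; have := expRNK h'; move: E; rewrite /cosh => E n' n.
have : (expR h - expR h') * (expR h - expR (- h')) = 0.
  have -> : (expR h - expR h') * (expR h - expR (- h')) = expR h *
     (expR h + expR (- h) - (expR h' + expR (- h'))) - expR h * expR (- h) +
     expR h' * expR (- h') by ring.
  rewrite n n' (_ : expR h + _ = expR h' + expR (- h')) ?subrr ?mulr0 ?sub0r ?addNr//.
  by move: E => /(congr1 (fun x => x * 2)); rewrite !divfK.
by move=> /eqP; rewrite mulf_eq0 !subr_eq0 => /orP[] /eqP/expR_inj; [left|right].
Qed.

(* the nonnegative [h] such that [cosh (2 h) ^+ 2 = X], for [1 <= X] *)
Definition hX (X : R) : R := ln (Num.sqrt X + Num.sqrt (X - 1)) / 2.

Lemma hX_hyp X : 1 <= X -> cosh (2 * hX X) = Num.sqrt X /\ sinh (2 * hX X) = Num.sqrt (X - 1).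
Proof.
move=> X1; have X0 : 0 <= X by rewrite (le_trans _ X1).
have sX : 0 < Num.sqrt X by rewrite sqrtr_gt0 (lt_le_trans _ X1).
have p : 0 < Num.sqrt X + Num.sqrt (X - 1) by rewrite ltr_wpDr ?sqrtr_ge0.
have e : expR (2 * hX X) = Num.sqrt X + Num.sqrt (X - 1).
  by rewrite /hX mulrC divfK// lnK.
have e' : expR (- (2 * hX X)) = Num.sqrt X - Num.sqrt (X - 1).
  apply: (@mulfI _ (expR (2 * hX X))); first by rewrite gt_eqF ?expR_gt0.
  rewrite expRNK e mulrC -subr_sqr !sqr_sqrtr// ?subr_ge0//; ring.
by rewrite /cosh /sinh e e'; split; field.
Qed.

(** The unitary factor preserves column norms, both columns of [exp (ihH)] have squared norm
    [cosh (2 * h)], and the torus scales the two columns inversely. *)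
Lemma mostow_colsq g u h k : mostow g u h k ->
  colsq g 0 = cosh (2 * h) / cmod k ^+ 2 /\ colsq g 1 = cosh (2 * h) * cmod k ^+ 2.
Proof.
move=> [[uU _] k0 ->]; rewrite invmx_torus// -mulmxA.
have kV0 : k^-1 != 0 by rewrite invr_eq0.
have [h1 h2] := colsq_torus (expmx (('i * realC h) *: Hmx R)) kV0.
rewrite !(@colsq_unitary u _ _ uU) h1 h2 cmodV exprVn invrK expmx_hyp cosh_double.
rewrite /colsq /hyp !mx2s !cmodM cmodN !cmod_realC.
have -> : cmod ('i : C) = 1 by rewrite /cmod normCi.
by rewrite !mul1r !real_normK ?num_real// [_ ^+ 2 + _]addrC -/(cosh h) -/(sinh h) addrC.
Qed.

(** It suffices to find [k] for which the Gram matrix of [g *m torus k] is [exp (2ihH)]: multiplying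
    by [exp (- ihH)] on the right then gives a unitary matrix. The modulus of [k] equalizes the
    column norms and its argument rotates the off-diagonal entry. *)
Lemma mostow_exists g : \det g = 1 ->
  exists u k, mostow g u (hX (colsq g 0 * colsq g 1)) k.
Proof.
move=> g1; have L := lagrange_identity g; rewrite g1 cmod1 expr1n in L.
set a := colsq g 0 in L *; set b := colsq g 1 in L *; set p := (g^t* *m g) 0 1 in L.
have X1 : 1 <= a * b by rewrite L lerDr sqr_ge0.
set h := hX (a * b); have [Hc Hs] := hX_hyp X1; rewrite -/h in Hc Hs.
have c0 : 0 < Num.sqrt (a * b) by rewrite sqrtr_gt0 (lt_le_trans _ X1).
have sE : Num.sqrt (a * b - 1) = cmod p by rewrite L addrK sqrtr_sqr ger0_norm ?cmod_ge0.
have a0 : 0 < a.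
  rewrite lt_neqAle addr_ge0 ?sqr_ge0// andbT; apply/eqP => a0.
  by move: X1; rewrite -a0 mul0r ler10.
set c := Num.sqrt (a * b) in Hc c0; set s := Num.sqrt (a * b - 1) in Hs sE.
have c2 : c ^+ 2 = a * b by rewrite sqr_sqrtr// (le_trans _ X1).
(* The phase that turns the off-diagonal entry [p] into [- 'i * cmod p]; any phase would do for
   [p = 0]. *)
pose th : C := if p == 0 then 1 else 'i * p / realC (cmod p).
have th1 : cmod th = 1.
  rewrite /th; case: eqVneq => [_|p0]; first exact: cmod1.
  rewrite !cmodM cmodV cmod_realC (_ : cmod 'i = 1) ?mul1r; last by rewrite /cmod normCi.
  by rewrite ger0_norm ?cmod_ge0// divff// cmod_eq0.
(* The torus multiplies the off-diagonal entry by [k^* / k], which is [th^-1], and the squared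
   column norms [a], [b] by [c / a] and its inverse, so that both become [c]. *)
pose k : C := sqrtC (realC (c / a) * th).
have k2 : k ^+ 2 = realC (c / a) * th by rewrite sqrtCK.
have ca0 : 0 < c / a by rewrite divr_gt0.
have kk : cmod k ^+ 2 = c / a.
  by rewrite -cmodX k2 cmodM th1 mulr1 cmod_realC gtr0_norm.
have k0 : k != 0 by apply/eqP => kz; move: ca0; rewrite -kk kz cmod0 expr0n ltxx.
have kr : k^* / k = th^-1.
  have th0 : th != 0 by rewrite -cmod_gt0 th1.
  have rca : realC (c / a) != 0 :> C by rewrite -cmod_gt0 cmod_realC normr_gt0 gt_eqF.
  have -> : k^* / k = k^* * k / k ^+ 2 by field.
  by rewrite k2 -realC_sqr_cmod kk invfM mulrA divff// mul1r.
have pth : p / th = - 'i * realC s.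
  rewrite sE /th; case: eqVneq => [->|p0]; first by rewrite mul0r cmod0 mulr0.
  have cp0 : realC (cmod p) != 0 :> C.
    by rewrite -cmod_gt0 cmod_realC normr_gt0 cmod_eq0.
  have i0 : ('i : C) != 0 by rewrite -cmod_gt0 /cmod normCi.
  by rewrite !invfM invrK invCi; move: (realC _) ('i : C) => r I; field.
have M : (g *m torus k)^t* *m (g *m torus k) = hyp c s.
  have [h1 h2] := colsq_torus g k0.
  have e01 : ((g *m torus k)^t* *m (g *m torus k)) 0 1 = - 'i * realC s.
    rewrite -pth -kr mulrC /p !gramE !mulmx2E !mx2s !mulr0 !addr0 !add0r !rmorphM/=.
    by ring.
  apply: mx2P; rewrite ?e01 -?colsq_gram /hyp ?mx2s//.
  - rewrite h1 -/a kk; congr realC; field; rewrite gt_eqF//.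
  - rewrite gramE mulrC [X in _ + X]mulrC -[LHS]conjCK rmorphD !rmorphM/= !conjCK.
    rewrite -gramE e01 rmorphM rmorphN/= conjCi opprK conj_realC//.
  - rewrite h2 -/b kk; congr realC; apply: (@mulIf _ c); first by rewrite gt_eqF.
    by rewrite -expr2 c2; field; rewrite !gt_eqF.
have uE : cosh h ^+ 2 - sinh h ^+ 2 = 1 := cosh2_sinh2 h.
have uE' : cosh h ^+ 2 = 1 + sinh h ^+ 2 by rewrite -uE; ring.
have tk : torus k *m invmx (torus k) = 1%:M.
  by rewrite invmx_torus// torusM divff// torus1.
exists (g *m torus k *m hyp (cosh h) (- sinh h)), k; split => //.
- split.
    apply/unitarymxP/mulmx1C; move: (g *m torus k) M => G M.
    rewrite trmx_mul map_mxM/= hyp_adj -mulmxA (mulmxA (G^t*)) M !hypM -hyp10.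
    by rewrite -Hc -Hs cosh_double sinh_double; congr hyp; ring: uE'.
  rewrite /= !det_mulmx g1 !det_mx2 !mx2s mul1r ?(mulr0, mul0r, subr0) divff// mul1r.
  have := sqrCi C; move: ('i : C) => I hI.
  rewrite -[RHS]realC1 -uE realCB !realCX realCN.
  by ring: hI.
- rewrite expmx_hyp -/(cosh h) -/(sinh h) -(mulmxA (g *m torus k)) hypM.
  rewrite (_ : cosh h * cosh h + _ = 1); last by rewrite -uE; ring.
  rewrite (_ : cosh h * sinh h + _ = 0); last by ring.
  by rewrite hyp10 mulmx1 -mulmxA tk mulmx1.
Qed.

End Mostow.

(** * Functions on the line bundle *)

Section Bundle.
Variables (R : realType) (m : int).
Local Notation C := (Cplx R).
Local Notation total := (SL2 R * C)%type.
Local Notation ambient := ('M[C]_2 * C)%type.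
Implicit Types (g : SL2 R) (z k : C) (h : R).

Lemma openLP (U : set (L R m)) :
  open U <-> open [set p : SL2 R * C | U (Lclass m p.1 p.2)].
Proof.
rewrite {1}/open /= /quotient_open /=.
rewrite (_ : _ @^-1` U = [set p : SL2 R * C | U (Lclass m p.1 p.2)])//.
by apply/funext => -[g z].
Qed.

Lemma Lclass_surj (x : L R m) : exists g z, x = Lclass m g z.
Proof.
pose p := repr (x : {eq_quot torus_orbit_equiv R m})%qT.
by exists p.1, p.2; rewrite /Lclass -surjective_pairing /p reprK.
Qed.

Lemma Lclass_eqP (g g' : SL2 R) (z z' : C) :
  Lclass m g z = Lclass m g' z' <-> torus_orbit m (g, z) (g', z').
Proof.
rewrite /Lclass; split.
  by move=> /eqquotP/asboolP.
by move=> h; apply/eqquotP/asboolP.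
Qed.

Lemma SL2_det (g : SL2 R) : \det (SL2mx g) = 1.
Proof. by have := set_valP g. Qed.

Definition mkSL2 (A : 'M[C]_2) (H : \det A = 1) : SL2 R := exist _ A (mem_set H).

Lemma mkSL2E (A : 'M[C]_2) (H : \det A = 1) : SL2mx (mkSL2 H) = A.
Proof. by rewrite /SL2mx set_valE. Qed.

Lemma SL2mx_continuous : continuous (@SL2mx R).
Proof. exact: initial_continuous. Qed.

Lemma Lclass_continuous : continuous (fun p : SL2 R * C => Lclass m p.1 p.2).
Proof.
rewrite (_ : (fun _ => _) = (fun p => \pi_({eq_quot torus_orbit_equiv R m})%qT p)); last first.
  by apply/funext => -[g z].
exact: (@pi_continuous _ {eq_quot torus_orbit_equiv R m}%qT).
Qed.

Lemma diff_fst (y : 'M[C]_2 * C) : differentiable (fun y : 'M[C]_2 * C => y.1) y.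
Proof. by apply: (@linear_differentiable _ _ _ fst) => z; exact: cvg_fst. Qed.

Lemma diff_snd (y : 'M[C]_2 * C) : differentiable (fun y : 'M[C]_2 * C => y.2) y.
Proof. by apply: (@linear_differentiable _ _ _ snd) => z; exact: cvg_snd. Qed.

Lemma diff_entry i j (y : 'M[C]_2 * C) :
  differentiable (fun y : 'M[C]_2 * C => y.1 i j) y.
Proof. exact: (differentiable_comp (diff_fst y) (differentiable_coord y.1 i j)). Qed.

Lemma diff_exp (G : ambient -> C) (k : nat) y : differentiable G y ->
  differentiable (fun y => G y ^+ k) y.
Proof.
move=> Gd; case: k => [|k].
  by rewrite (_ : (fun y => _) = cst 1)//; apply/funext => w; rewrite expr0.
rewrite (_ : (fun y => _) = G ^+ k.+1); first exact: differentiableX.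
by apply/funext => w; elim: k.+1 => [|l IH]; rewrite ?expr0// !exprS IH.
Qed.

Lemma diff_mul (G H : ambient -> C) y : differentiable G y -> differentiable H y ->
  differentiable (fun y => G y * H y) y.
Proof. by move=> Gd Hd; exact: (differentiableM Gd Hd). Qed.

Definition ambient_point (p : total) : ambient := (SL2mx p.1, p.2).

Lemma ambient_point_continuous : continuous ambient_point.
Proof.
move=> p.
have h1 : {for p, continuous (fun q : total => SL2mx q.1)}.
  exact: (continuous_comp (@cvg_fst _ _ _ _ _) (@SL2mx_continuous p.1)).
have h2 : {for p, continuous (fun q : total => q.2)} by exact: cvg_snd.
exact: (cvg_pair h1 h2).
Qed.

Definition invariant (F : total -> C) := forall p q, torus_orbit m p q -> F p = F q.

Definition lift (F : total -> C) (x : L R m) : C :=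
  F (repr (x : {eq_quot torus_orbit_equiv R m})%qT).

Lemma liftE F g z : invariant F -> lift F (Lclass m g z) = F (g, z).
Proof.
move=> Finv; apply/esym/Finv.
set p := repr _; have -> : p = (p.1, p.2) by case: p.
by apply/Lclass_eqP; rewrite /p /Lclass -surjective_pairing reprK.
Qed.

Lemma lift_holomorphic (G : ambient -> C) (V : set (L R m)) :
  invariant (G \o ambient_point) ->
  (forall g z, V (Lclass m g z) -> \forall y \near (SL2mx g, z), differentiable G y) ->
  holomorphic_on V (lift (G \o ambient_point)).
Proof.
move=> Ginv Gd g z Vgz; exists G; split; first exact: Gd.
have E (q : total) : lift (G \o ambient_point) (Lclass m q.1 q.2) = G (ambient_point q).
  by rewrite liftE//; case: q.
exact: (@filterE _ (nbhs ((g, z) : total)) _ _ E).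
Qed.

Lemma holomorphic_onS (V W : set (L R m)) (f : L R m -> C) : V `<=` W ->
  holomorphic_on W f -> holomorphic_on V f.
Proof. by move=> VW fW g z /VW; exact: fW. Qed.

(** Openness of a preimage is tested on [SL2 R * C], as [L] has the quotient topology; there the
    pull-back of [f] agrees locally with a differentiable function of the ambient space. *)
Lemma holomorphic_continuous (V : set (L R m)) (f : L R m -> C) x : open V ->
  holomorphic_on V f -> V x -> {for x, continuous f}.
Proof.
move=> Vo fV Vx P; rewrite nbhsE => -[Q [Qo Qx] QP].
have : open (V `&` f @^-1` Q).
  apply/openLP; rewrite openE => -[g z] [/= Vgz Qgz].
  have [G [Gd GE]] := fV g z Vgz.
  have FE := nbhs_singleton GE; rewrite /= in FE.
  have Gc : {for ambient_point (g, z), continuous G}.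
    exact: differentiable_continuous (nbhs_singleton Gd).
  have Gn : nbhs (G (ambient_point (g, z))) Q.
    by apply: open_nbhs_nbhs; rewrite /ambient_point/= -FE.
  have h1 : \forall p \near (g, z), Q (G (ambient_point p)).
    exact: (ambient_point_continuous (Gc _ Gn)).
  have h2 : \forall p \near ((g, z) : total), V (Lclass m p.1 p.2).
    by apply: open_nbhs_nbhs; split => //; exact/openLP.
  near=> p; split; first exact: (near h2 p).
  by rewrite /= (near GE p)//; exact: (near h1 p).
move=> o; apply: (@filterS _ _ _ (V `&` f @^-1` Q)); first by move=> y [_ /QP].
exact: open_nbhs_nbhs.
Unshelve. all: by end_near. Qed.

(* The column of [g] that scales by [k ^ -1] for [m > 0] and by [k] for [m < 0]:
   its powers of degree [`|m|] times the fibre coordinate are functions on L. *)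
Definition dcol : 'I_2 := if 0 <= m then 0 else 1.
Definition ocol : 'I_2 := if 0 <= m then 1 else 0.
Definition deg : nat := `|m|%N.

Lemma mul_invtorus (A : 'M[C]_2) k i : k != 0 ->
  (A *m invmx (torus k)) i 0 = A i 0 / k /\ (A *m invmx (torus k)) i 1 = A i 1 * k.
Proof.
by move=> k0; rewrite invmx_torus// !mulmx2E !mx2s invrK !mulr0 addr0 add0r.
Qed.

Lemma invtorus_dcol (A : 'M[C]_2) k i : k != 0 ->
  k ^ m * (A *m invmx (torus k)) i dcol ^+ deg = A i dcol ^+ deg.
Proof.
move=> k0; rewrite /dcol /deg; case: m => n /=.
  rewrite (mul_invtorus A i k0).1 expr_div_n mulrC divfK//.
  by rewrite expf_neq0.
rewrite (mul_invtorus A i k0).2 exprMn NegzE -exprnN mulrC mulfK// expf_neq0//.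
Qed.

Lemma invtorus_ocol (A : 'M[C]_2) k i : k != 0 ->
  (A *m invmx (torus k)) i ocol ^+ deg = k ^ m * A i ocol ^+ deg.
Proof.
move=> k0; rewrite /ocol /deg; case: m => n /=.
  by rewrite (mul_invtorus A i k0).2 exprMn mulrC.
by rewrite (mul_invtorus A i k0).1 expr_div_n NegzE -exprnN mulrC.
Qed.

Lemma SL2_col_neq0 (A : 'M[C]_2) j : \det A = 1 -> exists i, A i j != 0.
Proof.
move=> A1; apply: contrapT => /forallNP H.
have Z i : A i j = 0 by apply: contrapT => /eqP; exact: H.
have := oner_neq0 C; rewrite -A1 det_mx2 => /eqP; apply.
have [e|e] : j = 0 \/ j = 1.
- by case: j {H Z} => -[|[|//]] ?; [left|right]; exact: val_inj.
- by rewrite -e !Z mul0r mulr0 subrr.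
- by rewrite -e !Z mulr0 mul0r subrr.
Qed.

(** Three families of torus-invariant functions: [sec] is linear on the fibres of [L], [quad] comes
    from the base quadric, and [cosec] is a section of the dual bundle read as a function with a
    pole along the zero section. By the convention [0^-1 = 0], [cosec] has value [0] there, which is
    consistent with invariance. *)
Definition sec_amb i (y : ambient) : C := y.2 * y.1 i dcol ^+ deg.
Definition quad_amb a b (y : ambient) : C := y.1 a 0 * y.1 b 1.
Definition cosec_amb i (y : ambient) : C := y.2^-1 * y.1 i ocol ^+ deg.

Lemma sec_inv i : invariant (sec_amb i \o ambient_point).
Proof.
move=> [g z] [g' z'] [k [k0 /= gE zE]].
by rewrite /sec_amb/= gE zE mulrAC invtorus_dcol// mulrC.
Qed.

Lemma quad_inv a b : invariant (quad_amb a b \o ambient_point).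
Proof.
move=> [g z] [g' z'] [k [k0 /= gE zE]]; rewrite /quad_amb/= gE.
by rewrite (mul_invtorus _ _ k0).1 (mul_invtorus _ _ k0).2; field.
Qed.

Lemma cosec_inv i : invariant (cosec_amb i \o ambient_point).
Proof.
move=> [g z] [g' z'] [k [k0 /= gE zE]].
rewrite /cosec_amb/= gE zE invtorus_ocol// invfM mulrA -[_ * _ * k ^ m]mulrA.
by rewrite mulrCA mulVf ?mulr1// expfz_neq0.
Qed.

Lemma sec_diff i y : differentiable (sec_amb i) y.
Proof. exact: (diff_mul (diff_snd y) (diff_exp deg (diff_entry i dcol y))). Qed.

Lemma quad_diff a b y : differentiable (quad_amb a b) y.
Proof. exact: (diff_mul (diff_entry a 0 y) (diff_entry b 1 y)). Qed.

Lemma cosec_diff i (y : ambient) : y.2 != 0 -> differentiable (cosec_amb i) y.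
Proof.
move=> y0; have := differentiableV (diff_snd y) y0 => d.
exact: (diff_mul d (diff_exp deg (diff_entry i ocol y))).
Qed.

Definition sec i : L R m -> C := lift (sec_amb i \o ambient_point).
Definition quad a b : L R m -> C := lift (quad_amb a b \o ambient_point).
Definition cosec i : L R m -> C := lift (cosec_amb i \o ambient_point).

Lemma secE i g z : sec i (Lclass m g z) = z * SL2mx g i dcol ^+ deg.
Proof. by rewrite /sec liftE//; exact: sec_inv. Qed.

Lemma quadE a b g z : quad a b (Lclass m g z) = SL2mx g a 0 * SL2mx g b 1.
Proof. by rewrite /quad liftE//; exact: quad_inv. Qed.

Lemma cosecE i g z : cosec i (Lclass m g z) = z^-1 * SL2mx g i ocol ^+ deg.
Proof. by rewrite /cosec liftE//; exact: cosec_inv. Qed.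

Lemma sec_holomorphic i V : holomorphic_on V (sec i).
Proof.
apply: lift_holomorphic; [exact: sec_inv|move=> g z _].
exact: (@filterE _ (nbhs ((SL2mx g, z) : ambient)) _ _ (sec_diff i)).
Qed.

Lemma quad_holomorphic a b V : holomorphic_on V (quad a b).
Proof.
apply: lift_holomorphic; [exact: quad_inv|move=> g z _].
exact: (@filterE _ (nbhs ((SL2mx g, z) : ambient)) _ _ (quad_diff a b)).
Qed.

Lemma holomorphic_continuousT (f : L R m -> C) : holomorphic_on setT f -> continuous f.
Proof. by move=> fh x; apply: (holomorphic_continuous openT fh). Qed.

Lemma sec_continuous i : continuous (sec i).
Proof. by apply: holomorphic_continuousT; exact: sec_holomorphic. Qed.

Lemma quad_continuous a b : continuous (quad a b).
Proof. by apply: holomorphic_continuousT; exact: quad_holomorphic. Qed.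

(** The products [quad] determine the two columns up to inverse factors, that is, [g] up to the
    torus; a nonzero entry of the column [dcol] then lets [sec] recover the fibre coordinate. *)
Lemma Lclass_separated x y : (forall i, sec i x = sec i y) ->
  (forall a b, quad a b x = quad a b y) -> x = y.
Proof.
have [g [z ->]] := Lclass_surj x; have [g' [z' ->]] := Lclass_surj y => S Q.
have {}S i : z * SL2mx g i dcol ^+ deg = z' * SL2mx g' i dcol ^+ deg by rewrite -!secE.
have {}Q a b : SL2mx g a 0 * SL2mx g b 1 = SL2mx g' a 0 * SL2mx g' b 1.
  by have := Q a b; rewrite !quadE.
have [b gb] := SL2_col_neq0 1 (SL2_det g).
have [a ga] := SL2_col_neq0 0 (SL2_det g).
have [a' ga'] := SL2_col_neq0 0 (SL2_det g').
have [i' gi'] := SL2_col_neq0 dcol (SL2_det g').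
pose k := SL2mx g' b 1 / SL2mx g b 1.
have Q0 a1 : SL2mx g a1 0 = SL2mx g' a1 0 * k.
  by apply: (mulIf gb); rewrite Q /k; field.
have k0 : k != 0 by apply: contraNneq ga => k0; rewrite Q0 k0 mulr0.
have Q1 b1 : SL2mx g' b1 1 = SL2mx g b1 1 * k.
  by apply: (mulfI ga'); rewrite -Q Q0; ring.
have gE : SL2mx g' = SL2mx g *m invmx (torus k).
  apply: mx2P; rewrite ?(mul_invtorus _ _ k0).1 ?(mul_invtorus _ _ k0).2 ?Q0 ?Q1//;
  by rewrite mulfK.
apply/Lclass_eqP; exists k; split => //=.
apply: (@mulIf _ (SL2mx g' i' dcol ^+ deg)); first by rewrite expf_neq0.
by rewrite -S gE -(invtorus_dcol _ i' k0); ring.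
Qed.

(** The functions of [Lclass_separated] are continuous. The property serves to make compact
    holomorphic hulls closed. *)
Lemma L_hausdorff : hausdorff_space (L R m).
Proof.
have H (f : L R m -> C) x y : continuous f -> cluster (nbhs x) y -> f x = f y.
  move=> fc xy; apply: (@norm_hausdorff _ C) => A B /fc fA /fc fB.
  by have [w [wA wB]] := xy _ _ fA fB; exists (f w).
move=> x y xy; apply: Lclass_separated => [i|a b]; apply: H => //.
  exact: sec_continuous.
exact: quad_continuous.
Qed.

(** * Disc bundles in terms of the column norms *)

Definition nu (A : 'M[C]_2) : R := Num.sqrt (colsq A dcol).
Definition level g z : R := cmod z * nu (SL2mx g) ^+ deg.
Definition qprod (A : 'M[C]_2) : R := colsq A 0 * colsq A 1.

Lemma qprod_ge1 g : 1 <= qprod (SL2mx g).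
Proof.
by rewrite /qprod lagrange_identity SL2_det cmod1 expr1n lerDr sqr_ge0.
Qed.

Lemma colsq_ge0 (A : 'M[C]_2) j : 0 <= colsq A j.
Proof. by rewrite addr_ge0 ?sqr_ge0. Qed.

Lemma cmod_exprz k : cmod (k ^ m) = cmod k ^ m.
Proof.
case: m => n; first exact: cmodX.
by rewrite NegzE -!exprnN cmodV cmodX.
Qed.

Lemma colsq_invtorus (A : 'M[C]_2) k : k != 0 ->
  colsq (A *m invmx (torus k)) 0 = colsq A 0 / cmod k ^+ 2 /\
  colsq (A *m invmx (torus k)) 1 = colsq A 1 * cmod k ^+ 2.
Proof.
move=> k0; rewrite invmx_torus//; have kV0 : k^-1 != 0 by rewrite invr_eq0.
by have [-> ->] := colsq_torus A kV0; rewrite cmodV exprVn invrK.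
Qed.

Lemma level_class g z g' z' : Lclass m g z = Lclass m g' z' ->
  level g z = level g' z' /\ qprod (SL2mx g) = qprod (SL2mx g').
Proof.
move=> /Lclass_eqP[k [k0 /= gE zE]].
have ck : cmod k != 0 by rewrite cmod_eq0.
have [c0 c1] := colsq_invtorus (SL2mx g) k0.
split; last by rewrite /qprod gE c0 c1; field.
rewrite /level /nu gE zE cmodM cmod_exprz /dcol /deg; case: m => n /=.
  rewrite c0 sqrtrM ?colsq_ge0// sqrtrV ?sqr_ge0// sqrtr_sqr ger0_norm ?cmod_ge0//.
  by rewrite expr_div_n -exprnP; field; rewrite expf_neq0.
rewrite c1 sqrtrM ?colsq_ge0// sqrtr_sqr ger0_norm ?cmod_ge0// NegzE -exprnN.
by rewrite exprMn; field; rewrite expf_neq0.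
Qed.

(* By [mostow_psi], [Omega m rho] is [level * psi < 1] and [Omega_max] is
   [level < 1]. *)
Definition psi (rho : R -> R) (X : R) : R := rho (hX X) / rho_max m (hX X).

Lemma rho_maxE h : rho_max m h = Num.sqrt (cosh (2 * h)) ^+ deg.
Proof.
have c0 : 0 <= cosh (2 * h) by rewrite (le_trans _ (cosh_ge1 _)).
rewrite /rho_max (_ : (`|m|%:~R : R) = deg%:R); last by rewrite /deg -abszE.
by rewrite [_ / 2]mulrC powRrM powR_mulrn ?powR_ge0// powR12_sqrt.
Qed.

Lemma rho_max_gt0 h : 0 < rho_max m h.
Proof.
by rewrite rho_maxE exprn_gt0// sqrtr_gt0 (lt_le_trans _ (cosh_ge1 _)).
Qed.

Lemma rho_maxN h : rho_max m (- h) = rho_max m h.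
Proof. by rewrite !rho_maxE mulrN coshN. Qed.

(** By [mostow_colsq], the column [dcol] has norm [sqrt (cosh (2 * h))] times [cmod k] to the power
    [-1] or [1] according to the sign of [m]; its power of degree [deg] is therefore
    [rho_max m h * cmod k ^ (- m)]. The product of the column norms gives back [h] up to sign, and
    both profiles are even. *)
Lemma mostow_psi (rho : R -> R) (A u : 'M[C]_2) h k : (forall h, rho (- h) = rho h) ->
  mostow A u h k ->
  cmod k ^ (- m) * rho h = nu A ^+ deg * psi rho (qprod A).
Proof.
move=> rhoN M; have [c0 c1] := mostow_colsq M; have [_ k0 _] := M.
have ck : cmod k != 0 by rewrite cmod_eq0.
have ch0 : 0 < cosh (2 * h) by rewrite (lt_le_trans _ (cosh_ge1 _)).
have qE : qprod A = cosh (2 * h) ^+ 2 by rewrite /qprod c0 c1; field.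
have -> : psi rho (qprod A) = rho h / rho_max m h.
  have q1 : 1 <= qprod A by rewrite qE exprn_ege1// cosh_ge1.
  have hE : cosh (2 * hX (qprod A)) = cosh (2 * h).
    by rewrite (hX_hyp q1).1 qE sqrtr_sqr gtr0_norm.
  rewrite /psi; have [E|E] := cosh_inj hE.
    by rewrite (_ : hX _ = h)//; apply: (mulfI (_ : 2 != 0)) E; rewrite pnatr_eq0.
  rewrite (_ : hX _ = - h) ?rhoN ?rho_maxN//.
  by apply: (mulfI (_ : 2 != 0)); rewrite ?pnatr_eq0// mulrN.
have rm := rho_max_gt0 h; rewrite mulrCA mulrC; congr (_ * _).
rewrite rho_maxE /nu /dcol /deg; case: m => n /=.
  rewrite c0 sqrtrM ?(ltW ch0)// sqrtrV ?sqr_ge0// sqrtr_sqr ger0_norm ?cmod_ge0//.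
  rewrite expr_div_n -exprnN mulrAC divff ?mul1r//.
  by rewrite expf_neq0// gt_eqF// sqrtr_gt0.
rewrite c1 sqrtrM ?(ltW ch0)// sqrtr_sqr ger0_norm ?cmod_ge0// NegzE opprK.
by rewrite exprMn mulrAC divff ?mul1r// expf_neq0// gt_eqF// sqrtr_gt0.
Qed.

Lemma OmegaP (rho : R -> R) g z : (forall h, rho (- h) = rho h) ->
  Omega m rho (Lclass m g z) <-> level g z * psi rho (qprod (SL2mx g)) < 1.
Proof.
move=> rhoN.
have K (A u : 'M[C]_2) h k w : mostow A u h k ->
   `|w| * `|k| ^ (- m) * realC (rho h) = realC (cmod w * nu A ^+ deg * psi rho (qprod A)).
  move=> M; rewrite -[cmod w * _ * _]mulrA -(mostow_psi rhoN M) !realCM -normcE mulrA.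
  congr (_ * _ * _).
  rewrite normcE; case: (- m) => n; first by rewrite realCX.
  by rewrite NegzE -!exprnN realCV realCX.
split.
  move=> [g' [z' [u [h [k [E M]]]]]]; rewrite (K _ _ _ _ _ M) -realC1 ltr_realC.
  by have [-> ->] := level_class E.
move=> lt1; have [u [k M]] := mostow_exists (SL2_det g).
exists g, z, u, (hX (qprod (SL2mx g))), k; split => //.
by rewrite (K _ _ _ _ _ M) -realC1 ltr_realC.
Qed.

End Bundle.

(** * Continuity principle along unipotent lines *)

Section Curves.
Variables (R : realType) (m : int).
Local Notation C := (Cplx R).
Local Notation total := (SL2 R * C)%type.
Local Notation ambient := ('M[C]_2 * C)%type.
Implicit Types (z k : C) (h : R).

Definition unip (t : C) : 'M[C]_2 := if 0 <= m then mx2 1 t 0 1 else mx2 1 0 t 1.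

Lemma det_unip t : \det (unip t) = 1.
Proof. by rewrite det_mx2 /unip; case: ifP => _; rewrite !mx2s; ring. Qed.

Lemma unipE t : unip t = unip 0 + t *: delta_mx (dcol m) (ocol m).
Proof.
rewrite /unip /dcol /ocol; case: ifP => _;
by apply: mx2P; rewrite !mxE /= ?mulr0 ?addr0 ?add0r ?mulr1.
Qed.

Definition unipSL t : SL2 R := mkSL2 (det_unip t).

Lemma unip_differentiable (a : C -> C) t : derivable a t 1 ->
  differentiable (fun t => unip (a t)) t.
Proof.
move=> /derivable1_diffP ad; rewrite (_ : (fun t => _) =
  (fun t => unip 0 + a t *: delta_mx (dcol m) (ocol m))); last first.
  by apply/funext => w; rewrite [LHS]unipE.
exact: (differentiableD (differentiable_cst _ _) (differentiableZl _ ad)).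
Qed.

Lemma unipSL_continuous : continuous unipSL.
Proof.
apply: continuous_comp_initial => t.
have := differentiable_continuous (unip_differentiable (derId t)).
exact.
Qed.

Lemma curve_continuous (a b : C -> C) t : {for t, continuous a} -> {for t, continuous b} ->
  {for t, continuous (fun t => (unipSL (a t), b t) : total)}.
Proof.
move=> ac bc; have h : {for t, continuous (fun t => unipSL (a t))}.
  exact: (continuous_comp ac (@unipSL_continuous (a t))).
exact: (cvg_pair h bc).
Qed.

Lemma holomorphic_curve (V : set (L R m)) (f : L R m -> C) (a b : C -> C) t :
  holomorphic_on V f -> V (Lclass m (unipSL (a t)) (b t)) ->
  derivable a t 1 -> derivable b t 1 ->
  derivable (fun t => f (Lclass m (unipSL (a t)) (b t))) t 1.
Proof.
move=> fV Vt ad bd; have [G [Gd GE]] := fV _ _ Vt.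
have cc := curve_continuous (derivable_continuous_at ad) (derivable_continuous_at bd).
pose P t := (unip (a t), b t) : ambient.
have Pd : differentiable P t.
  by apply: differentiable_pair; [exact: unip_differentiable|exact/derivable1_diffP].
have G0 : differentiable G (P t).
  by have := nbhs_singleton Gd; rewrite /= mkSL2E.
have /derivable1_diffP := differentiable_comp Pd G0.
apply: near_eq_derivable.
by apply: (@filterS _ (nbhs t) _ _ _ _ (cc _ GE)) => w /= ->; rewrite mkSL2E.
Qed.

(** The real parameter [s] moves the whole disc, starting at [s = 0] inside the zero section. *)
Definition disc_point (a r : C -> C) (s : R) (t : C) : L R m :=
  Lclass m (unipSL (a t)) (realC s * r t).

Lemma disc_point_continuous (a r : C -> C) (s : R) (t : C) :
  {for t, continuous a} -> {for t, continuous r} ->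
  {for (s, t), continuous (fun p : R * C => disc_point a r p.1 p.2)}.
Proof.
move=> ac rc.
have c2 : {for (s, t), continuous (fun p : R * C => p.2)} by exact: cvg_snd.
have c1 : {for (s, t), continuous (fun p : R * C => p.1)} by exact: cvg_fst.
have ac2 : {for t, continuous (fun t => unipSL (a t))}.
  exact: (continuous_comp ac (@unipSL_continuous (a t))).
have h1 : {for (s, t), continuous (fun p : R * C => unipSL (a p.2))}.
  exact: (continuous_comp c2 ac2).
have rcc : {for s, continuous (fun x : R => realC x : C)}.
  move=> P /nbhsCP[e e0 HP]; apply/nbhs_ballP; exists e => // x sx; apply: HP.
  by rewrite -realCB cmod_realC distrC.
have h2 : {for (s, t), continuous (fun p : R * C => realC p.1 : C)}.
  exact: (continuous_comp c1 rcc).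
have h3 : {for (s, t), continuous (fun p : R * C => r p.2)}.
  exact: (continuous_comp c2 rc).
have h4 : {for (s, t), continuous
    (fun p : R * C => (unipSL (a p.2), realC p.1 * r p.2) : total)}.
  exact: (cvg_pair h1 (contM h2 h3)).
exact: (continuous_comp h4 (@Lclass_continuous R m _)).
Qed.

(* The set of [s] for which the whole disc lies in [W] is open because [K] is
   compact, and closed because such discs lie in the hull of the boundaries. *)
Lemma continuity_principle (W : set (L R m)) (K B : set C) (a r : C -> C) (s1 : R) :
  stein W -> compact K -> compact B -> B `<=` K -> B !=set0 ->
  (forall t, K t -> derivable a t 1 /\ derivable r t 1) ->
  (forall t, K t -> B t \/ nbhs t K) -> 0 <= s1 ->
  (forall t, K t -> W (Lclass m (unipSL (a t)) 0)) ->
  (forall s t, 0 <= s <= s1 -> B t -> W (disc_point a r s t)) ->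
  forall t, K t -> W (disc_point a r s1 t).
Proof.
move=> [Wo _ Wh] Kc Bc BK [b0 Bb0] Kd KB s10 W0 WB.
have cont s t : K t -> {for (s, t), continuous (fun p : R * C => disc_point a r p.1 p.2)}.
  by move=> /Kd[ad rd]; apply: disc_point_continuous; exact: derivable_continuous_at.
pose A := (fun p : R * C => disc_point a r p.1 p.2) @` (`[0, s1] `*` B).
have AW : A `<=` W.
  by move=> _ [[s t] [/= + Bt] <-]; rewrite in_itv/= => hs; exact: WB.
have Ac : compact A.
  apply: continuous_compact; last by apply: compact_setX => //; exact: segment_compact.
  apply: continuous_in_subspaceT => -[s t]; rewrite inE => -[_ /BK Kt]; exact: cont.
pose H := holomorphic_hull W A.
have Hc : closed H by apply: compact_closed; [exact: L_hausdorff|exact: Wh].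
have DH s : 0 <= s <= s1 -> (forall t, K t -> W (disc_point a r s t)) ->
    forall t, K t -> H (disc_point a r s t).
  move=> hs Ws t Kt; split; first exact: Ws.
  move=> f fh M fM; rewrite normcE ler_realC.
  have FM t' : B t' -> cmod (f (disc_point a r s t')) <= M.
    move=> Bt; rewrite -ler_realC -normcE; apply: fM.
    by exists (s, t') => //; split => //=; rewrite in_itv.
  have M0 : 0 <= M by apply: le_trans (FM _ Bb0); exact: cmod_ge0.
  have Fd t' : K t' -> derivable (fun t => f (disc_point a r s t)) t' 1.
    move=> Kt'; have [ad rd] := Kd t' Kt'.
    exact: (@holomorphic_curve W f a (fun t => realC s * r t) t' fh (Ws t' Kt') ad
      (derM (derC (realC s : C) t') rd)).
  exact: (@max_modulus R K B (fun t => f (disc_point a r s t)) 0 M Kc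
    (fun t Kt => derivable_continuous_at (Fd t Kt)) (fun t Kt _ => Fd t Kt) KB M0
    (fun t _ => FM t) t Kt).
pose D := [set s : R | forall t, K t -> W (disc_point a r s t)].
pose E := [set s : R | forall t, K t -> H (disc_point a r s t)].
have Do : open D.
  rewrite openE => s Ds; have /compact_near_coveringP Kn := Kc.
  apply: (Kn R (nbhs s) (fun s t => W (disc_point a r s t))) => t Kt.
  have Wn : nbhs (disc_point a r s t) W by apply: open_nbhs_nbhs; split => //; exact: Ds.
  have := cont s t Kt _ Wn => -[[P Q] [/= Ps Qt] PQ].
  by exists (Q, P) => // -[t' s'] [/= Qt' Ps']; exact: (PQ (s', t')).
have Ec : closed E.
  rewrite (_ : E = \bigcap_(t in K) [set s | H (disc_point a r s t)]); last first.
    by apply/seteqP; split => s /=.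
  apply: closed_bigI => t Kt.
  apply: (@preimage_closed _ _ (fun s => disc_point a r s t)) => // s _.
  have cs : {for s, continuous (fun s : R => (s, t))}.
    have h1 : {for s, continuous (fun s : R => s)} by move=> P.
    exact: (cvg_pair h1 (@cst_continuous _ _ t s)).
  exact: (continuous_comp cs (cont s t Kt)).
have DE : [set` `[0, s1]] `&` D = [set` `[0, s1]].
  apply: (@segment_connected R 0 s1).
  - exists 0; split; first by rewrite /= in_itv/= lexx.
    by move=> t Kt; rewrite /disc_point realC0 mul0r; exact: W0.
  - by exists D.
  - exists E => //; apply/seteqP; split => s [s01 hs]; split => // t Kt.
      by apply: DH => //; move: s01; rewrite /= in_itv.
    by have [] := hs t Kt.
have : ([set` `[0, s1]] `&` D) s1 by rewrite DE /= in_itv/= s10 lexx.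
by move=> [_ Ds1]; exact: Ds1.
Qed.

(** * Restriction to a unipotent line and the lower bound of psi *)

Lemma colsq_unip t : colsq (unip t) (dcol m) = 1 /\ qprod (unip t) = 1 + cmod t ^+ 2.
Proof.
rewrite /qprod /colsq /unip /dcol; case: ifP => _; rewrite !mx2s !cmod0 !cmod1;
by split; ring.
Qed.

Lemma Omega_unip (rho : R -> R) t z : (forall h, rho (- h) = rho h) ->
  Omega m rho (Lclass m (unipSL t) z) <-> cmod z * psi m rho (1 + cmod t ^+ 2) < 1.
Proof.
move=> /OmegaP -> ; have [c q] := colsq_unip t.
by rewrite /level /nu mkSL2E c q sqrtr1 expr1n mulr1.
Qed.

Lemma psi1 (rho : R -> R) : psi m rho 1 = rho 0.
Proof.
rewrite /psi (_ : hX 1 = 0); last by rewrite /hX sqrtr1 subrr sqrtr0 addr0 ln1 mul0r.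
rewrite rho_maxE mulr0 /cosh oppr0 expR0 (_ : (1 + 1) / 2 = 1); last by field.
by rewrite sqrtr1 expr1n divr1.
Qed.

Lemma psi_gt0 (rho : R -> R) (X : R) : (forall h, 0 < rho h) -> 0 < psi m rho X.
Proof. by move=> rho0; rewrite divr_gt0// rho_max_gt0. Qed.

(** If [psi] were below [1] at [X = 1 + t0 ^+ 2], the circles of radius [t0] at heights [s <= 1]
    would lie in the bundle, hence also the centre [[U(0), 1]]; but [psi] is [rho 0 = 1] there,
    which puts this point on the edge. *)
Lemma psi_ge1 (rho : R -> R) (X : R) : disc_bundle_profile rho -> rho 0 = 1 ->
  stein (Omega m rho) -> 1 <= X -> 1 <= psi m rho X.
Proof.
move=> [rho0 rhoN _] r1 st X1; rewrite leNgt; apply/negP => lt1.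
have X0 : 0 <= X - 1 by rewrite subr_ge0.
pose t0 := Num.sqrt (X - 1); have t00 : 0 <= t0 by exact: sqrtr_ge0.
have t0X : 1 + t0 ^+ 2 = X by rewrite sqr_sqrtr// addrC subrK.
have ct0 : cmod (realC t0 : C) = t0 by rewrite cmod_realC ger0_norm.
have := @continuity_principle (Omega m rho) [set t | cmod t <= t0] [set t | cmod t = t0]
  id (fun=> 1) 1 st.
move=> /(_ _ _ _ _ _ _ _ _ _ 0) H.
suff : Omega m rho (disc_point id (fun=> 1) 1 0).
  rewrite /disc_point Omega_unip// realC1 mulr1 cmod1 cmod0 expr0n addr0 psi1 r1 mulr1.
  by rewrite ltxx.
apply: H => //=.
- by apply: (@compact_cmod _ [set x | x <= t0] t0) => //; exact: closed_le.
- by apply: (@compact_cmod _ [set x | x = t0] t0) => [|x ->/=]//; exact: closed_eq.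
- by move=> t /= ->.
- by exists (realC t0).
- move=> t /=; rewrite le_eqVlt => /predU1P[->|tr]; first by left.
  right; apply/nbhsCP; exists (t0 - cmod t); first by rewrite subr_gt0.
  move=> w wz /=; rewrite -[w](subrK t) (le_trans (cmodD _ _))// -lerBrDr.
  exact: ltW.
- by move=> t _; rewrite Omega_unip// cmod0 mul0r.
- move=> s t /andP[s0 s1] tt; rewrite Omega_unip// mulr1 cmod_realC ger0_norm// tt t0X.
  by apply: le_lt_trans lt1; rewrite ler_piMl// ltW// psi_gt0.
- by rewrite cmod0.
Qed.

Lemma psi_max (X : R) : psi m (rho_max m) X = 1.
Proof. by rewrite /psi divff// gt_eqF// rho_max_gt0. Qed.

Lemma Omega_sub_max (rho : R -> R) : disc_bundle_profile rho -> rho 0 = 1 ->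
  stein (Omega m rho) -> Omega m rho `<=` Omega_max R m.
Proof.
move=> prho r1 st x; have [g [z ->]] := Lclass_surj x; have [rho0 rhoN _] := prho.
move=> /(OmegaP m g z rhoN) lt1; apply/OmegaP; first exact: rho_maxN.
rewrite psi_max mulr1; apply: le_lt_trans lt1.
rewrite ler_peMr ?psi_ge1 ?qprod_ge1//.
by rewrite /level mulr_ge0 ?cmod_ge0// exprn_ge0// sqrtr_ge0.
Qed.

(** * Growth of psi *)

Lemma exists_expr_gt (q M : R) : 1 < q -> exists n, M < q ^+ n.+1.
Proof.
move=> q1; have x0 : 0 < q - 1 by rewrite subr_gt0.
have B n : 1 + n%:R * (q - 1) <= q ^+ n.
  elim: n => [|n IH]; first by rewrite mul0r addr0 expr0.
  rewrite exprS; apply: (@le_trans _ _ (q * (1 + n%:R * (q - 1)))); last first.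
    by rewrite ler_pM2l// (lt_trans _ q1).
  rewrite -natr1; have : 0 <= n%:R * (q - 1) * (q - 1).
    by rewrite !mulr_ge0// ltW.
  by move: (n%:R) => y; clear; nra.
pose n := Num.bound (`|M| / (q - 1)); exists n.
have h : `|M| / (q - 1) < n%:R by apply: archi_boundP; rewrite divr_ge0// ltW.
apply: le_lt_trans (ler_norm M) _.
have : `|M| < n%:R * (q - 1) by rewrite -ltr_pdivrMr.
have : q ^+ n <= q ^+ n.+1.
  by rewrite exprS ler_peMl ?exprn_ge0// ?(ltW q1)// (le_trans ler01)// ltW.
have := B n; clear; lra.
Qed.

Lemma exists_root (x : R) n : 0 < x -> exists2 y, 0 < y & y ^+ n.+1 = x.
Proof.
move=> x0; exists (x `^ (n.+1%:R^-1)); first exact: powR_gt0.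
rewrite -powR_mulrn ?powR_ge0// -powRrM mulVf ?pnatr_eq0//.
by rewrite powRr1// ltW.
Qed.

Lemma cosh_le (x y : R) : 0 <= x -> x <= y -> cosh x <= cosh y.
Proof.
move=> x0 xy; rewrite /cosh ler_pM2r//.
have := expRNK x; have := expRNK y.
have : expR x <= expR y by rewrite ler_expR.
have : 1 <= expR x by rewrite -expR0 ler_expR.
have := expR_gt0 (- x); have := expR_gt0 (- y).
move: (expR x) (expR y) (expR (- x)) (expR (- y)) => a b c d.
move=> d0 c0 a1 ab bd ac; have -> : a + c = b + d - (b - a) * (1 - c * d).
  have -> : (b - a) * (1 - c * d) = b - a - (b * d) * c + (a * c) * d by ring.
  by rewrite bd ac; ring.
rewrite gerBl mulr_ge0 ?subr_ge0// mulr_ile1 ?(ltW c0) ?(ltW d0)//; nra.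
Qed.

(** Upper semicontinuity of [rho] at [0] is transported to [X = 1] through [X1 = cosh (2 * h1) ^+ 2]
    with small [h1 > 0]; dividing by [rho_max], which is at least [1], can only lower the value. The
    result provides the inner circle of the annuli. *)
Lemma psi_near_1 (rho : R -> R) (X0 p0 : R) : disc_bundle_profile rho -> rho 0 < p0 ->
  1 < X0 -> exists X1, [/\ 1 < X1, X1 <= X0 & psi m rho X1 < p0].
Proof.
move=> [rho0 rhoN usc] r0p X01; have X01' := ltW X01.
have [d /= d0 Hd] := (nbhs_ballP _ _).1 (usc 0 p0 r0p).
have hp : 0 < hX X0.
  rewrite /hX divr_gt0// ln_gt0//.
  have h1 : 1 <= Num.sqrt X0 by rewrite -sqrtr1 ler_sqrt// (le_trans ler01).
  by rewrite (le_lt_trans h1)// ltrDl sqrtr_gt0 subr_gt0.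
pose h1 := Num.min (d / 2) (hX X0).
have h10 : 0 < h1 by rewrite lt_min hp divr_gt0.
have h1d : h1 < d.
  by rewrite gt_min; apply/orP; left; rewrite ltr_pdivrMr// ltr_pMr// ltr1n.
have h1X : h1 <= hX X0 by rewrite ge_min lexx orbT.
have c1 : 1 < cosh (2 * h1).
  have := cosh2_sinh2 (2 * h1); have s0 : 0 < sinh (2 * h1).
    by rewrite /sinh divr_gt0// subr_gt0 ltr_expR; move: h10; clear; lra.
  have := cosh_ge1 (2 * h1); rewrite le_eqVlt => /predU1P[<-|//].
  by rewrite expr1n => /eqP; rewrite -subr_eq0 addrAC subrr sub0r oppr_eq0 sqrf_eq0 gt_eqF.
have q1 : 1 <= cosh (2 * h1) ^+ 2 by rewrite exprn_ege1// ltW.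
exists (cosh (2 * h1) ^+ 2); split.
- by rewrite exprn_egt1.
- have [cX _] := hX_hyp X01'; rewrite -(sqr_sqrtr (le_trans ler01 X01')) -cX.
  rewrite ler_sqr ?nnegrE ?(le_trans ler01 (cosh_ge1 _))//.
  by apply: cosh_le; [rewrite mulr_ge0// ltW|rewrite ler_pM2l].
- have hE : cosh (2 * hX (cosh (2 * h1) ^+ 2)) = cosh (2 * h1).
    by rewrite (hX_hyp q1).1 sqrtr_sqr gtr0_norm// (lt_trans ltr01).
  have -> : psi m rho (cosh (2 * h1) ^+ 2) = rho h1 / rho_max m h1.
    rewrite /psi; have [E|E] := cosh_inj hE.
      by rewrite (_ : hX _ = h1)//; apply: (mulfI (_ : 2 != 0)) E; rewrite pnatr_eq0.
    rewrite (_ : hX _ = - h1) ?rhoN ?rho_maxN//.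
    by apply: (mulfI (_ : 2 != 0)); rewrite ?pnatr_eq0// mulrN.
  apply: (@le_lt_trans _ _ (rho h1)).
    rewrite ler_pdivrMr ?rho_max_gt0// ler_peMr ?(ltW (rho0 _))//.
    rewrite rho_maxE exprn_ege1// -sqrtr1 ler_sqrt ?cosh_ge1//.
    by rewrite (le_trans ler01)// cosh_ge1.
  by apply: Hd; rewrite /ball/= sub0r normrN gtr0_norm.
Qed.

Lemma derExp (n : nat) (t : C) : derivable (fun t : C => t ^+ n) t 1.
Proof.
elim: n => [|n IH].
  by rewrite (_ : (fun t => t ^+ 0) = fun=> 1); [exact: derC|apply/funext => w; rewrite expr0].
rewrite (_ : (fun t => t ^+ n.+1) = fun t => t * t ^+ n).
  exact: (derM (derId t) IH).
by apply/funext => w; rewrite exprS.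
Qed.

(* The curve [tau |-> [U (t1 tau ^ n), s / tau]] over an annulus; this is the
   convexity of [log psi] as a function of [log |t|]. *)
Lemma psi_annulus (rho : R -> R) n (t1 y0 y2 : R) : disc_bundle_profile rho ->
  stein (Omega m rho) -> 0 < t1 -> 1 <= y0 -> y0 <= y2 ->
  let p y := psi m rho (1 + (t1 * y ^+ n) ^+ 2) in
  y0 * p 1 < p y0 -> y2 * p y0 <= y0 * p y2.
Proof.
move=> [rho0 rhoN _] st t10 y01 y02 p p1p0; rewrite leNgt; apply/negP => lt2.
have pg y : 0 < p y by exact: psi_gt0.
have y00 : 0 < y0 by rewrite (lt_le_trans ltr01).
have y20 : 0 < y2 by rewrite (lt_le_trans y00).
(* The value of [s] for which the point over [cmod tau = y0] is exactly on the edge of the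
   bundle. *)
pose s1 := y0 / p y0; have s10 : 0 < s1 by rewrite divr_gt0.
pose a (t : C) : C := realC t1 * t ^+ n; pose r (t : C) : C := t^-1.
have W s (t : C) : 0 <= s ->
    Omega m rho (disc_point a r s t) <-> s * p (cmod t) / cmod t < 1.
  move=> s0; rewrite Omega_unip// !cmodM cmodV cmodX !cmod_realC (gtr0_norm t10).
  by rewrite ger0_norm// mulrAC.
clearbody p.
have cpos (t : C) : 1 <= cmod t -> t != 0.
  by move=> ct; rewrite -cmod_gt0 (lt_le_trans ltr01).
have cont (c : R) : closed [set x : R | x = c] by exact: closed_eq.
have : Omega m rho (disc_point a r s1 (realC y0)).
  apply: (@continuity_principle (Omega m rho) [set t | 1 <= cmod t <= y2]
    [set t | cmod t = 1 \/ cmod t = y2] a r s1 st).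
  - apply: (@compact_cmod _ [set x | 1 <= x <= y2] y2); last by move=> x /= /andP[].
    rewrite (_ : [set x | _] = [set x | 1 <= x] `&` [set x | x <= y2]).
      by apply: closedI; [exact: closed_ge|exact: closed_le].
    by apply/seteqP; split => x /=; [move=> /andP[]|move=> [-> ->]].
  - apply: (@compact_cmod _ [set x | x = 1 \/ x = y2] y2).
      by apply: closedU; exact: cont.
    by move=> x /= [->|->//]; rewrite (le_trans y01).
  - by move=> t /= [->|->]; rewrite ?lexx ?(le_trans y01 y02).
  - by exists 1; left; exact: cmod1.
  - move=> t /= /andP[/cpos tn0 _]; split; last exact: (derV (derId t) tn0).
    exact: (derM (derC (realC t1) t) (@derExp n t)).
  - move=> t /= /andP[]; rewrite le_eqVlt => /predU1P[<-|lt1]; first by left; left.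
    rewrite le_eqVlt => /predU1P[->|ltt2]; first by left; right.
    right; apply/nbhsCP; exists (Num.min (cmod t - 1) (y2 - cmod t)).
      by rewrite lt_min !subr_gt0 lt1.
    move=> w; rewrite lt_min => /andP[w1 w2] /=.
    have h1 : cmod t <= cmod w + cmod (w - t).
      by rewrite cmodB -[X in cmod X <= _](subrK w t) addrC cmodD.
    have h2 : cmod w <= cmod t + cmod (w - t).
      by rewrite -[X in cmod X <= _](subrK t w) addrC cmodD.
    by apply/andP; split; move: w1 w2 h1 h2; clear; lra.
  - exact: ltW.
  - by move=> t _; apply/(Omega_unip _ _ rhoN); rewrite cmod0 mul0r.
  - move=> s t /andP[s0 ss1] tB; rewrite W//.
    (* At [y = 1] the premise of [L] is the hypothesis on [p 1], at [y = y2] the negated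
       conclusion. *)
    have L y : 0 < y -> y0 * p y < y * p y0 -> s * p y / y < 1.
      move=> y_0 H; rewrite ltr_pdivrMr// mul1r.
      apply: (@le_lt_trans _ _ (s1 * p y)); first by rewrite ler_pM2r.
      by rewrite /s1 mulrAC ltr_pdivrMr.
    by case: tB => ->; apply: L => //; rewrite mul1r.
  - by rewrite /= cmod_realC gtr0_norm// y01.
rewrite W ?(ltW s10)// cmod_realC gtr0_norm// /s1 divfK ?gt_eqF//.
by rewrite divff ?gt_eqF// ltxx.
Qed.

(** Between an inner point [X1] close to [1] and [X0], [psi] increases strictly. In the variable [y]
    with [|t| = t1 * y ^+ n.+1] the increase is steep enough for [psi_annulus], after which [psi]
    grows at least linearly in [y], and its power [n.+1] at least linearly in [|t|]. *)
Lemma psi_growth (rho : R -> R) (X0 : R) : disc_bundle_profile rho -> rho 0 = 1 ->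
  stein (Omega m rho) -> 1 <= X0 -> psi m rho X0 != 1 ->
  exists N (c : R), 0 < c /\ forall X, 1 <= X -> Num.sqrt X <= c * psi m rho X ^+ N.
Proof.
move=> prho r1 st X01 psiN1; have [rho0 rhoN usc] := prho.
have pge X := psi_ge1 prho r1 st (X := X).
have psi_1 := psi1 rho; rewrite r1 in psi_1.
have p01 : 1 < psi m rho X0 by rewrite lt_neqAle eq_sym psiN1 pge.
have X01' : 1 < X0.
  by rewrite lt_neqAle X01 andbT; apply: contraNneq psiN1 => <-; rewrite psi_1.
have [X1 [X11 X1X0 p1p0]] : exists X1, [/\ 1 < X1, X1 <= X0 & psi m rho X1 < psi m rho X0].
  by apply: psi_near_1 => //; rewrite r1.
have ann n t1 y0 y2 := @psi_annulus rho n t1 y0 y2 prho st.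
move: (psi m rho) ann pge psi_1 p01 p1p0 => p ann pge _ p01 p1p0 {psiN1 usc}.
have sqX X : 1 <= X -> 1 + Num.sqrt (X - 1) ^+ 2 = X.
  by move=> X_1; rewrite sqr_sqrtr ?subr_ge0// addrC subrK.
have sqle X Y : 1 <= X -> X <= Y -> Num.sqrt (X - 1) <= Num.sqrt (Y - 1).
  by move=> X_1 XY; rewrite ler_sqrt ?subr_ge0 ?lerB// (le_trans X_1).
have [t1 [t10 t1E]] : exists t1, 0 < t1 /\ t1 = Num.sqrt (X1 - 1).
  by exists (Num.sqrt (X1 - 1)); rewrite sqrtr_gt0 subr_gt0.
have p10 : 0 < p X1 by rewrite (lt_le_trans ltr01)// pge// ltW.
have p00 : 0 < p X0 by rewrite (lt_trans ltr01).
have q1 : 1 < p X0 / p X1 by rewrite ltr_pdivlMr// mul1r.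
(* The left side is [y0 ^+ n.+1] for the [y0] that corresponds to [X0], so this choice of [n] says
   [y0 * p X1 < p X0], the hypothesis of the annulus argument. *)
have [n Hn] := exists_expr_gt (Num.sqrt (X0 - 1) / t1) q1.
have root X : X0 <= X -> exists y, [/\ 0 < y, t1 * y ^+ n.+1 = Num.sqrt (X - 1) &
    1 + (t1 * y ^+ n.+1) ^+ 2 = X].
  move=> XX; have X_1 : 1 < X by rewrite (lt_le_trans X01').
  have s0 : 0 < Num.sqrt (X - 1) / t1 by rewrite divr_gt0// sqrtr_gt0 subr_gt0.
  have [y y0 yE] := exists_root n s0.
  have E : t1 * y ^+ n.+1 = Num.sqrt (X - 1) by rewrite yE mulrC divfK// gt_eqF.
  by exists y; rewrite E sqX ?ltW.
have root_le y y' : 0 < y -> 0 < y' -> t1 * y ^+ n.+1 <= t1 * y' ^+ n.+1 -> y <= y'.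
  by move=> y0 y'0; rewrite ler_pM2l// ler_pXn2r// nnegrE ltW.
have [y0 [y00 y0s y0E]] := root X0 (lexx _).
have y01 : 1 <= y0.
  by apply: root_le => //; rewrite expr1n mulr1 y0s t1E sqle// ltW.
have y0p : y0 * p X1 < p X0.
  rewrite -ltr_pdivlMr// -(@ltr_pXn2r _ n.+1)// ?nnegrE ?ltW ?divr_gt0//.
  by apply: le_lt_trans Hn; rewrite -y0s mulrAC divff ?gt_eqF// mul1r.
(* The first summand serves for [X >= X0]; the second bounds the remaining range, where [p X >= 1].
   The extra [1] in the final constant absorbs the passage from [Num.sqrt X] to
   [Num.sqrt (X - 1)]. *)
pose c0 := t1 * (y0 / p X0) ^+ n.+1 + Num.sqrt (X0 - 1).
have t00 : 0 <= Num.sqrt (X0 - 1) by exact: sqrtr_ge0.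
have k0 : 0 < t1 * (y0 / p X0) ^+ n.+1 by rewrite mulr_gt0// exprn_gt0// divr_gt0.
have c00 : 0 < c0 by rewrite ltr_wpDr.
exists n.+1, (1 + c0); split; first by rewrite addr_gt0.
move=> X X_1; have pX := exprn_ege1 n.+1 (pge X X_1).
have sX : Num.sqrt X <= 1 + Num.sqrt (X - 1).
  rewrite -ler_sqr ?nnegrE ?sqrtr_ge0 ?addr_ge0 ?sqrtr_ge0//.
  rewrite sqr_sqrtr ?(le_trans ler01)// sqrrD expr1n mul1r -addrA addrCA.
  by rewrite sqX// lerDr mulrn_wge0// sqrtr_ge0.
apply: (le_trans sX); rewrite mulrDl mul1r lerD//.
have [X0X|/ltW XX0] := leP X0 X; last first.
  apply: (@le_trans _ _ (Num.sqrt (X0 - 1))); first exact: sqle.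
  apply: (@le_trans _ _ c0); first by rewrite lerDr ltW.
  by rewrite ler_peMr// ltW.
have [y2 [y20 y2s y2E]] := root X X0X.
have y02 : y0 <= y2 by apply: root_le => //; rewrite y0s y2s sqle.
have := ann n.+1 t1 y0 y2 t10 y01 y02; rewrite /= y0E y2E expr1n mulr1 t1E sqX ?(ltW X11)//.
move=> /(_ y0p) H.
have y2le : y2 <= y0 / p X0 * p X by rewrite mulrAC ler_pdivlMr.
rewrite -y2s; apply: (@le_trans _ _ (t1 * (y0 / p X0) ^+ n.+1 * p X ^+ n.+1)); last first.
  by rewrite ler_pM2r ?lerDl// (lt_le_trans ltr01).
rewrite -mulrA -exprMn ler_pM2l// ler_pXn2r// nnegrE ?(ltW y20)//.
exact: le_trans (ltW y20) y2le.
Qed.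

End Curves.

(** * Hyperbolicity and Steinness of the punctured bundle *)

Section Hyperbolic.
Variables (R : realType) (m : int).
Local Notation C := (Cplx R).
Implicit Types (z : C) (x y : L R m).

(** Along each disc the Schwarz lemma bounds the variation of [f] by the Poincaré distance; the
    variations add up along the chain. *)
Lemma disc_chain_bound (W : set (L R m)) (f : L R m -> C) (M : R) s x y :
  holomorphic_on setT f -> 0 <= M -> (forall x, W x -> cmod (f x) <= M) ->
  disc_chain W x s y ->
  cmod (f x - f y) <= 4 * M * \sum_(d <- s) poincare_dist d.2.1 d.2.2.
Proof.
move=> fh M0 fM; elim: s x => [|[phi [a b]] s IH] x /=.
  by move=> ->; rewrite subrr cmod0 big_nil mulr0.
move=> [[phiW _ phih] a1 b1 <- /IH h2].
have disc t : unit_disc t -> cmod t < 1.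
  by rewrite /unit_disc/= normcE -realC1 ltr_realC.
have disc' t : cmod t < 1 -> unit_disc t.
  by rewrite /unit_disc/= normcE -realC1 ltr_realC.
have h1 : cmod (f (phi a) - f (phi b)) <= 4 * M * poincare_dist a b.
  apply: (@le_trans _ _ (4 * M * (cmod (a - b) / cmod (1 - b^* * a)))).
    apply: (@schwarz_bound R (f \o phi)) => //; try exact: disc.
      by move=> t /disc' t1; apply: (phih setT f openT fh).
    by move=> t /disc' /phiW; exact: fM.
  by rewrite ler_wpM2l ?mulr_ge0// poincare_dist_ge// disc.
rewrite big_cons/= mulrDr; apply: le_trans (lerD h1 h2).
rewrite (_ : f (phi a) - f y = (f (phi a) - f (phi b)) + (f (phi b) - f y)) ?cmodD//.
by ring.
Qed.

Lemma kobayashi_bounded (W : set (L R m)) (f : L R m -> C) (M : R) x y :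
  holomorphic_on setT f -> (forall x, W x -> cmod (f x) <= M) ->
  kobayashi_dist W x y = 0%E -> f x = f y.
Proof.
move=> fh fM k0.
(* A strictly positive bound, to divide by. *)
pose M' := `|M| + 1; have M'0 : 0 < M' by rewrite ltr_wpDl.
have fM' w : W w -> cmod (f w) <= M'.
  by move=> /fM h; rewrite (le_trans h)// (le_trans (ler_norm M))// lerDl.
have p0 : 0 < 4 * M' by rewrite mulr_gt0.
have : ((cmod (f x - f y) / (4 * M'))%:E <= kobayashi_dist W x y)%E.
  apply: le_ereal_inf_tmp => _ [s /= sc <-].
  rewrite lee_fin ler_pdivrMr// mulrC.
  by apply: (disc_chain_bound fh _ fM' sc); exact: ltW.
rewrite k0 lee_fin ler_pdivrMr// mul0r => h.
apply/eqP; rewrite -subr_eq0 -cmod_eq0 eq_le cmod_ge0 andbT; exact: h.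
Qed.

Lemma sec_level i (g : SL2 R) z : cmod (sec i (Lclass m g z)) <= level m g z.
Proof.
rewrite secE cmodM cmodX /level ler_wpM2l ?cmod_ge0//.
apply: lerXn2r; rewrite ?nnegrE ?cmod_ge0 ?sqrtr_ge0//.
rewrite -[leLHS]ger0_norm ?cmod_ge0// -sqrtr_sqr ler_sqrt ?colsq_ge0//.
rewrite /colsq; have [->|->] : i = 0 \/ i = 1.
- by case: i => -[|[|//]] ?; [left|right]; exact: val_inj.
- by rewrite lerDl sqr_ge0.
- by rewrite lerDr sqr_ge0.
Qed.

Lemma quad_qprod a b (g : SL2 R) z :
  cmod (quad a b (Lclass m g z)) <= Num.sqrt (qprod (SL2mx g)).
Proof.
have h i j : cmod (SL2mx g i j) ^+ 2 <= colsq (SL2mx g) j.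
  have [->|->] : i = 0 \/ i = 1.
  - by case: i => -[|[|//]] ?; [left|right]; exact: val_inj.
  - by rewrite lerDl sqr_ge0.
  - by rewrite lerDr sqr_ge0.
rewrite quadE -[leLHS]ger0_norm ?cmod_ge0// -sqrtr_sqr ler_sqrt; last first.
  by rewrite mulr_ge0 ?colsq_ge0.
by rewrite cmodM exprMn ler_pM ?sqr_ge0.
Qed.

(** The factor [quad] alone may be unbounded; since [cmod (sec i x)] is below the inverse of [psi],
    the power [N] from [psi_growth] compensates it. Where [sec i] is nonzero, the factor cancels and
    [quad] is recovered. *)
Definition separator N i a b x : C := sec i x ^+ N * quad a b x.

Lemma separator_holomorphic N i a b : holomorphic_on setT (separator N i a b).
Proof.
move=> g z _; exists (fun p => sec_amb m i p ^+ N * quad_amb a b p); split.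
  have d (p : 'M[C]_2 * C) := diff_mul (diff_exp N (sec_diff m i p)) (quad_diff a b p).
  exact: (@filterE _ (nbhs ((SL2mx g, z) : 'M[C]_2 * C)) _ _ d).
have E (q : SL2 R * C) : separator N i a b (Lclass m q.1 q.2) =
    sec_amb m i (SL2mx q.1, q.2) ^+ N * quad_amb a b (SL2mx q.1, q.2).
  by rewrite /separator secE quadE.
exact: (@filterE _ (nbhs ((g, z) : SL2 R * C)) _ _ E).
Qed.

Lemma Omega_hyperbolic (rho : R -> R) : disc_bundle_profile rho -> rho 0 = 1 ->
  stein (Omega m rho) -> Omega m rho <> Omega_max R m ->
  kobayashi_hyperbolic (Omega_punctured m rho).
Proof.
move=> prho r1 st nmax; have [rho0 rhoN _] := prho.
have [X0 X01 psiX0] : exists2 X0, 1 <= X0 & psi m rho X0 != 1.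
  apply: contrapT => /forall2NP H; apply: nmax; apply/seteqP; split.
    exact: Omega_sub_max.
  move=> x; have [g [z ->]] := Lclass_surj x.
  move=> /(OmegaP m g z (rho_maxN m)); rewrite psi_max => h; apply/OmegaP => //.
  have [/negP//|/negP/negPn/eqP->//] := H (qprod (SL2mx g)); last by rewrite qprod_ge1.
have [N [c [c0 Hc]]] := psi_growth prho r1 st X01 psiX0.
have psige X := psi_ge1 prho r1 st (X := X).
have bound1 x i : Omega_punctured m rho x -> cmod (sec i x) <= 1.
  move=> [xO _]; have [g [z xE]] := Lclass_surj x; move: xO; rewrite xE.
  move=> /(OmegaP m g z rhoN) h; apply: (le_trans (sec_level i g z)).
  apply: le_trans (ltW h); rewrite ler_peMr ?psige ?qprod_ge1//.
  exact: le_trans (cmod_ge0 _) (sec_level 0 g z).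
have bound2 x i a b : Omega_punctured m rho x -> cmod (separator N i a b x) <= c.
  move=> [xO _]; have [g [z xE]] := Lclass_surj x; move: xO; rewrite xE.
  move=> /(OmegaP m g z rhoN) h; rewrite cmodM cmodX.
  have l0 := le_trans (cmod_ge0 _) (sec_level 0 g z).
  have p0 : 0 <= psi m rho (qprod (SL2mx g)) by rewrite ltW// psi_gt0.
  apply: (@le_trans _ _ (level m g z ^+ N * (c * psi m rho (qprod (SL2mx g)) ^+ N))).
    apply: ler_pM; rewrite ?exprn_ge0 ?cmod_ge0//.
      by apply: lerXn2r; rewrite ?nnegrE ?cmod_ge0// sec_level.
    by apply: le_trans (quad_qprod a b g z) _; apply: Hc; exact: qprod_ge1.
  rewrite mulrCA -exprMn ler_piMr ?(ltW c0)// exprn_ile1//; first by rewrite mulr_ge0.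
  exact: ltW.
move=> x y xO yO k0.
have secxy i : sec i x = sec i y.
  exact: (kobayashi_bounded (@sec_holomorphic R m i setT) (fun x => bound1 x i) k0).
apply: Lclass_separated => // a b.
have [i si] : exists i, sec i x != 0.
  have [_ [g [z [-> z0]]]] := xO.
  have [i gi] := SL2_col_neq0 (dcol m) (SL2_det g).
  by exists i; rewrite secE mulf_neq0// expf_neq0.
have := kobayashi_bounded (@separator_holomorphic N i a b) (fun x => bound2 x i a b) k0.
by rewrite /separator -secxy => /mulfI; apply; rewrite expf_neq0.
Qed.

(** * Removing the zero section from a Stein set *)

Lemma nonzeroP x : (exists g z, x = Lclass m g z /\ z != 0) <-> exists i, sec i x != 0.
Proof.
split.
  move=> [g [z [-> z0]]]; have [i gi] := SL2_col_neq0 (dcol m) (SL2_det g).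
  by exists i; rewrite secE mulf_neq0// expf_neq0.
have [g [z ->]] := Lclass_surj x; move=> [l]; rewrite secE => zg; exists g, z; split => //.
by apply: contraNneq zg => ->; rewrite mul0r.
Qed.

Lemma open_sec_neq0 i : open [set x : L R m | sec i x != 0].
Proof.
rewrite openE => x /= sx.
suff /(@sec_continuous R m i x) : nbhs (sec i x) [set w : C | w != 0] by [].
apply/nbhsCP; exists (cmod (sec i x)); first by rewrite cmod_gt0.
by move=> w; apply: contraTneq => ->; rewrite sub0r cmodN ltxx.
Qed.

(** For [W = Omega m rho] this unfolds to [Omega_punctured m rho]. *)
Definition punctured (W : set (L R m)) : set (L R m) :=
  [set x | W x /\ exists g z, x = Lclass m g z /\ z != 0].

Lemma open_punctured W : open W -> open (punctured W).
Proof.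
move=> Wo; rewrite (_ : punctured W = \bigcup_i (W `&` [set x : L R m | sec i x != 0])).
  by apply: bigcup_open => i _; apply: openI => //; exact: open_sec_neq0.
apply/seteqP; split => x.
  by move=> [Wx /nonzeroP[i si]]; exists i.
by move=> [i _ [Wx si]]; split => //; apply/nonzeroP; exists i.
Qed.

Lemma cosec_holomorphic W i : holomorphic_on (punctured W) (cosec i).
Proof.
apply: lift_holomorphic; first exact: cosec_inv.
move=> g z [_ /nonzeroP[l]]; rewrite secE => zg.
have z0 : z != 0 by apply: contraNneq zg => ->; rewrite mul0r.
have zn : nbhs z [set w : C | w != 0].
  apply/nbhsCP; exists (cmod z); first by rewrite cmod_gt0.
  by move=> w; apply: contraTneq => ->; rewrite sub0r cmodN ltxx.
have pn : nbhs ((SL2mx g, z) : 'M[C]_2 * C) [set p | p.2 != 0] by exact: (cvg_snd zn).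
by apply: (@filterS _ (nbhs ((SL2mx g, z) : 'M[C]_2 * C)) _ _ _ _ pn) => p; exact: cosec_diff.
Qed.

(** The function [quad] with its indices ordered by [dcol] and [ocol] instead of [0] and [1], as
    needed to express the product of [sec] and [cosec], where the fibre coordinate cancels. *)
Definition cross l i x : C := if 0 <= m then quad l i x else quad i l x.

Lemma cross_continuous l i : continuous (cross l i).
Proof.
by rewrite /cross; case: (0 <= m); exact: quad_continuous.
Qed.

Lemma crossE l i (g : SL2 R) z :
  cross l i (Lclass m g z) = SL2mx g l (dcol m) * SL2mx g i (ocol m).
Proof.
by rewrite /cross /dcol /ocol; case: (0 <= m); rewrite quadE// mulrC.
Qed.

Lemma sec_cosec l i x : (exists g z, x = Lclass m g z /\ z != 0) ->
  sec l x * cosec i x = cross l i x ^+ deg m.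
Proof. by move=> [g [z [-> z0]]]; rewrite secE cosecE crossE exprMn; field. Qed.

Lemma compact_holomorphic_bounded (A V : set (L R m)) (f : L R m -> C) : open V ->
  holomorphic_on V f -> A `<=` V -> compact A -> exists M : R, forall x, A x -> cmod (f x) <= M.
Proof.
move=> Vo fV AV Ac; have [A0|A0] := pselect (A !=set0); last first.
  by exists 0 => x Ax; exfalso; apply: A0; exists x.
have fc : {within A, continuous (fun x => cmod (f x))}.
  apply: continuous_in_subspaceT => x; rewrite inE => /AV Vx.
  exact: (continuous_cmod (holomorphic_continuous Vo fV Vx)).
have [x0 _ H] := compact_EVT_max A0 Ac fc.
by exists (cmod (f x0)) => x Ax; apply: H; rewrite inE.
Qed.

(** This is a bound on [cosec] cleared of its denominator: it involves only functions continuous on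
    all of [L], so it survives limits that might reach the zero section. *)
Lemma closed_cross (M : R) l i :
  closed [set x : L R m | cmod (cross l i x) ^+ deg m <= M * cmod (sec l x)].
Proof.
pose F (x : L R m) := M * cmod (sec l x) - cmod (cross l i x ^+ deg m).
have Fc x : {for x, continuous F}.
  have h1 := continuous_cmod (@sec_continuous R m l x).
  have h2 := continuous_cmod (contX (@cross_continuous l i x) (n := deg m)).
  have h3 : {for x, continuous (fun y : L R m => M * cmod (sec l y))}.
    have h4 : {for x, continuous (fun=> M)} by exact: (@cst_continuous _ _ M x).
    exact: (cvgM h4 h1).
  exact: (cvgB h3 h2).
rewrite (_ : [set x : L R m | _] = F @^-1` [set r | 0 <= r]).
  by apply: preimage_closed => [x _|]; [exact: Fc|exact: closed_ge].
by apply/seteqP; split => x; rewrite /F /= subr_ge0 cmodX.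
Qed.

(* The sections [cosec] of the dual bundle have a pole along the zero section,
   hence keep the holomorphic hulls away from it. *)
Lemma stein_punctured W : stein W -> stein (punctured W).
Proof.
move=> [Wo Wsep Wh]; have Po := open_punctured Wo.
have PW : punctured W `<=` W by move=> x [].
split => //.
  move=> x y [Wx _] [Wy _] /(Wsep _ _ Wx Wy)[f fW fxy]; exists f => //.
  exact: holomorphic_onS fW.
move=> A AP Ac; have AW := subset_trans AP PW.
set H := holomorphic_hull _ _.
have HK : H `<=` holomorphic_hull W A.
  move=> x [[Wx _] Hx]; split => // f fW; apply: Hx.
  exact: holomorphic_onS fW.
(* The hull lies in the compact hull taken in [W], so only its closedness is at stake. *)
have Kc := Wh A AW Ac; apply: (subclosed_compact _ Kc HK).
have Kcl := compact_closed (@L_hausdorff R m) Kc.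
move=> x clx; have Wx : W x by have [] := Kcl x (closure_subset HK clx).
have Px : punctured W x.
  split => //; apply/nonzeroP; have [g [z xE]] := Lclass_surj x.
  have [l gl] := SL2_col_neq0 (dcol m) (SL2_det g).
  have [i gi] := SL2_col_neq0 (ocol m) (SL2_det g).
  have [M HM] := compact_holomorphic_bounded Po (@cosec_holomorphic W i) AP Ac.
  (* On the hull [cosec i] is bounded by its bound [M] on [A]. At the limit [x] the left side is
     positive by the choice of [l] and [i], which forces [sec l x] to be nonzero. *)
  exists l; have : cmod (cross l i x) ^+ deg m <= M * cmod (sec l x).
    apply: (@closed_cross M l i); apply: closure_subset clx => y [[Wy ny] Hy].
    rewrite /= -cmodX -(sec_cosec l i ny) cmodM mulrC ler_wpM2r ?cmod_ge0//.
    rewrite -ler_realC -normcE; apply: Hy; first exact: cosec_holomorphic.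
    by move=> y' /HM; rewrite normcE ler_realC.
  by apply: contraTneq => ->; rewrite cmod0 mulr0 -ltNge exprn_gt0// xE crossE cmod_gt0 mulf_neq0.
(* Now that [x] is known to lie in the punctured set, [f] is continuous at [x] and its bound passes
   to the closure. *)
split => // f fP M fM; rewrite normcE ler_realC leNgt; apply/negP => Mf.
have fc := continuous_cmod (holomorphic_continuous Po fP Px).
have Mn : nbhs (cmod (f x)) [set r : R | M < r].
  by apply: open_nbhs_nbhs; split => //; exact: open_gt.
have [y [[_ Hy] /= My]] := clx _ (fc _ Mn).
by have := Hy f fP M fM; rewrite normcE ler_realC leNgt My.
Qed.

End Hyperbolic.

Theorem theorem5p4 (R : realType) (m : int) :
  (forall rho : R -> R, disc_bundle_profile rho -> rho 0 = 1 ->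
     stein (Omega m rho) -> Omega m rho `<=` Omega_max R m)
  /\
  (forall rho : R -> R, disc_bundle_profile rho -> rho 0 = 1 ->
     stein (Omega m rho) -> Omega m rho <> Omega_max R m ->
     stein (Omega_punctured m rho) /\
     kobayashi_hyperbolic (Omega_punctured m rho)).
Proof.
split=> rho prho r1 st; first exact: Omega_sub_max.
move=> nmax; split; last exact: Omega_hyperbolic.
exact: (stein_punctured st).
Qed.
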